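(* The inverse orbit map at $0$, $\mathcal{M}(\mathbb{B})\to\mathbb{B}$, $\mathcal{F}\mapsto\mathcal{F}^{-1}(0)$, is smooth and induces a well defined map $$\mathcal{M}(\mathbb{B})_0\backslash\mathcal{M}(\mathbb{B})\to\mathbb{B},\qquad\mathcal{M}(\mathbb{B})_0\mathcal{F}\mapsto\mathcal{F}^{-1}(0),$$ which is a diffeomorphism.
   Context: $\mathbb{H}$ denotes the quaternions and $\mathbb{B}=\{q\in\mathbb{H}: |q|<1\}$. $\mathrm{Sp}(1,1)=\{A\in M_2(\mathbb{H}): A^*I_{1,1}A=I_{1,1}\}$ with $I_{1,1}=\operatorname{diag}(1,-1)$, a Lie group. $\mathrm{Sp}(1)=\{q\in\mathbb{H}:|q|=1\}$, and $\mathrm{Sp}(1)I_2=\{uI_2:u\in\mathrm{Sp}(1)\}$, a closed subgroup of $\mathrm{Sp}(1,1)$. A function $f:\mathbb{B}\to\mathbb{H}$ is (left) slice regular if for every $I\in\mathbb{H}$ with $I^2=-1$ one has $\frac12\left(\frac{\partial}{\partial x}+I\frac{\partial}{\partial y}\right)f(x+Iy)=0$ whenever $x,y\in\mathbb{R}$, $x+yI\in\mathbb{B}$. Such functions have power series expansions $f(q)=\sum_n q^na_n$ on $\mathbb{B}$. For $f(q)=\sum q^na_n$ and $g(q)=\sum q^nb_n$, the $*$-product is $(f*g)(q)=\sum_n q^n\sum_{k=0}^n a_kb_{n-k}$; the regular conjugate is $f^c(q)=\sum q^n\overline{a_n}$; the symmetrization is $f^s=f*f^c$; the $*$-reciprocal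 is $f^{-*}(q)=f^s(q)^{-1}f^c(q)$ off the zero set of $f^s$. For $a,b\in\mathbb{H}$ let $l_{(a,b)}(q)=qa+b$. For $A=\begin{pmatrix}a&c\\ b&d\end{pmatrix}\in\mathrm{Sp}(1,1)$, the slice regular M\''obius transformation $\mathcal{F}_A:\mathbb{B}\to\mathbb{B}$ is $\mathcal{F}_A=l_{(c,d)}^{-*}*l_{(a,b)}$, written $\mathcal{F}_A(q)=(qc+d)^{-*}*(qa+b)$. Set $\mathcal{M}(\mathbb{B})=\{\mathcal{F}_A:A\in\mathrm{Sp}(1,1)\}$. Each $\mathcal{F}_A$ is a well defined slice regular bijection of $\mathbb{B}$ onto itself; $\mathcal{F}^{-1}$ denotes the inverse map of the bijection $\mathcal{F}:\mathbb{B}\to\mathbb{B}$. Manifold structure: $\mathrm{Sp}(1,1)/\mathrm{Sp}(1)I_2$ carries the unique manifold structure for which the quotient map from $\mathrm{Sp}(1,1)$ is a submersion, and $\mathcal{M}(\mathbb{B})$ carries the manifold structure for which the bijection $\mathrm{Sp}(1,1)/\mathrm{Sp}(1)I_2\to\mathcal{M}(\mathbb{B})$, $A\,\mathrm{Sp}(1)I_2\mapsto\mathcal{F}_{A^{-1}}$, is a diffeomorphism. $\mathcal{M}(\mathbb{B})_0=\{\mathcal{F}\in\mathcal{M}(\mathbb{B}):\mathcal{F}(0)=0\}=\{R_u:u\in\mathrm{Sp}(1)\}$, with $R_u(q)=qu$. It is a compact submanifold of $\mathcal{M}(\mathbb{B})$ and a Lie group under composition, and $u\mapsto R_{u^{-1}}$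 is a Lie group isomorphism $\mathrm{Sp}(1)\to\mathcal{M}(\mathbb{B})_0$. It acts smoothly, freely and properly on the left of $\mathcal{M}(\mathbb{B})$ by $(\mathcal{F}_0,\mathcal{F})\mapsto\mathcal{F}_0\circ\mathcal{F}$. The orbit of $\mathcal{F}$ is denoted $\mathcal{M}(\mathbb{B})_0\mathcal{F}$, and the orbit space $\mathcal{M}(\mathbb{B})_0\backslash\mathcal{M}(\mathbb{B})$ carries the unique manifold structure for which the quotient map from $\mathcal{M}(\mathbb{B})$ is a submersion. *)

(* Defs.v *)
From HB Require Import structures.
From mathcomp Require Import all_boot all_order all_algebra.
From mathcomp Require Import ring.
From mathcomp Require Import all_classical all_reals all_analysis.
Import numFieldNormedType.Exports.
Set Implicit Arguments.
Unset Strict Implicit.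
Unset Printing Implicit Defensive.
Import Order.TTheory GRing.Theory Num.Theory.
Local Open Scope classical_set_scope.
Local Open Scope ring_scope.

(* The quaternion x0 + x1 i + x2 j + x3 k is the vector (x0, x1, x2, x3) of
   R^4, from which it inherits its topology. The norm [`|q|] that [quat]
   inherits is the sup norm of R^4; the modulus of q is [qabs q] below. *)
Definition quat (R : realType) := 'rV[R]_4.

HB.instance Definition _ (R : realType) :=
  NormedModule.copy (quat R) 'rV[R]_4.

Section Quaternions.
Variable R : realType.
Implicit Types p q r : quat R.

Definition mkquat (a b c d : R) : quat R := \row_i [:: a; b; c; d]`_i.

Definition qr q : R := q 0 0.
Definition qi q : R := q 0 1.
Definition qj q : R := q 0 2%:R.
Definition qk q : R := q 0 3%:R.

Lemma quatP p q :
  qr p = qr q -> qi p = qi q -> qj p = qj q -> qk p = qk q -> p = q.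
Proof.
rewrite /qr /qi /qj /qk => h0 h1 h2 h3; apply/rowP => i.
case: i => -[|[|[|[|//]]]] hi; [move: h0|move: h1|move: h2|move: h3];
  by congr (p _ _ = q _ _); apply/val_inj.
Qed.

Lemma mkquatE a b c d :
  (qr (mkquat a b c d) = a) * (qi (mkquat a b c d) = b) *
  (qj (mkquat a b c d) = c) * (qk (mkquat a b c d) = d).
Proof. by rewrite /qr /qi /qj /qk !mxE. Qed.

Lemma quatDE p q :
  (qr (p + q) = qr p + qr q) * (qi (p + q) = qi p + qi q) *
  (qj (p + q) = qj p + qj q) * (qk (p + q) = qk p + qk q).
Proof. by rewrite /qr /qi /qj /qk !mxE. Qed.

Lemma quatZE (a : R) q :
  (qr (a *: q) = a * qr q) * (qi (a *: q) = a * qi q) *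
  (qj (a *: q) = a * qj q) * (qk (a *: q) = a * qk q).
Proof. by rewrite /qr /qi /qj /qk !mxE. Qed.

Lemma quat0E :
  (qr (0 : quat R) = 0) * (qi (0 : quat R) = 0) *
  (qj (0 : quat R) = 0) * (qk (0 : quat R) = 0).
Proof. by rewrite /qr /qi /qj /qk !mxE. Qed.

Definition qmul p q : quat R := mkquat
  (qr p * qr q - qi p * qi q - qj p * qj q - qk p * qk q)
  (qr p * qi q + qi p * qr q + qj p * qk q - qk p * qj q)
  (qr p * qj q - qi p * qk q + qj p * qr q + qk p * qi q)
  (qr p * qk q + qi p * qj q - qj p * qi q + qk p * qr q).

Definition qone : quat R := mkquat 1 0 0 0.

Lemma qmulA : associative qmul.
Proof. by move=> p q r; apply: quatP; rewrite !mkquatE; ring. Qed.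

Lemma qmul1q : left_id qone qmul.
Proof. by move=> q; apply: quatP; rewrite !mkquatE; ring. Qed.

Lemma qmulq1 : right_id qone qmul.
Proof. by move=> q; apply: quatP; rewrite !mkquatE; ring. Qed.

Lemma qmulDl : left_distributive qmul +%R.
Proof.
by move=> p q r; apply: quatP; rewrite !(mkquatE, quatDE); ring.
Qed.

Lemma qmulDr : right_distributive qmul +%R.
Proof.
by move=> p q r; apply: quatP; rewrite !(mkquatE, quatDE); ring.
Qed.

Lemma qone_neq0 : qone != 0.
Proof.
apply/eqP => /(congr1 qr); rewrite mkquatE quat0E.
by apply/eqP; rewrite oner_eq0.
Qed.

HB.instance Definition _ := GRing.Zmodule_isNzRing.Build (quat R)
  qmulA qmul1q qmulq1 qmulDl qmulDr qone_neq0.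

Definition qconj q : quat R := mkquat (qr q) (- qi q) (- qj q) (- qk q).

Definition qsqn q : R := qr q ^+ 2 + qi q ^+ 2 + qj q ^+ 2 + qk q ^+ 2.

Definition qabs q : R := Num.sqrt (qsqn q).

Definition qinv q : quat R := (qsqn q)^-1 *: qconj q.

Lemma qsqn_eq0 q : (qsqn q == 0) = (q == 0).
Proof.
apply/idP/eqP => [|->]; last by rewrite /qsqn !quat0E !expr0n !addr0.
rewrite /qsqn !paddr_eq0 ?addr_ge0 ?sqr_ge0// !sqrf_eq0.
by move=> /andP[/andP[/andP[/eqP h0 /eqP h1] /eqP h2] /eqP h3];
  apply: quatP; rewrite !quat0E.
Qed.

Fact qmulVq : {in [pred q : quat R | q != 0], left_inverse 1 qinv *%R}.
Proof.
move=> q; rewrite inE -qsqn_eq0 => q0.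
apply: quatP; rewrite !(mkquatE, quatZE) /qsqn in q0 *; field => //.
Qed.

Fact qmulqV : {in [pred q : quat R | q != 0], right_inverse 1 qinv *%R}.
Proof.
move=> q; rewrite inE -qsqn_eq0 => q0.
apply: quatP; rewrite !(mkquatE, quatZE) /qsqn in q0 *; field => //.
Qed.

Fact quat_unit p q : q * p = 1 /\ p * q = 1 -> p \in [pred q : quat R | q != 0].
Proof.
move=> [+ _]; rewrite inE => qp; apply/eqP => p0; move: qp.
by rewrite p0 mulr0 => /eqP; rewrite eq_sym oner_eq0.
Qed.

Fact qinv_out : {in [predC [pred q : quat R | q != 0]], qinv =1 id}.
Proof.
move=> q; rewrite !inE negbK => /eqP ->.
by rewrite /qinv (eqP (_ : qsqn 0 == 0)) ?qsqn_eq0// invr0 scale0r.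
Qed.

HB.instance Definition _ := GRing.NzRing_hasMulInverse.Build (quat R)
  qmulVq qmulqV quat_unit qinv_out.

End Quaternions.

Section SliceRegular.
Variable R : realType.
Implicit Types (f g : quat R -> quat R) (a b : nat -> quat R).

Definition unit_ball : set (quat R) := [set q | qabs q < 1].

Definition qpseries a (q : quat R) : nat -> quat R :=
  series (fun n => q ^+ n * a n).

(* [coefs f] is the coefficient sequence of the expansion of f on the unit
   ball (it is unique), and 0 if f has none. *)
Definition coefs f : nat -> quat R :=
  xget (fun=> 0)
    [set a | forall q, unit_ball q -> qpseries a q @ \oo --> f q].

Definition qpsum a (q : quat R) : quat R := lim (qpseries a q @ \oo).

Definition star f g : quat R -> quat R :=
  qpsum (fun n => \sum_(k < n.+1) coefs f k * coefs g (n - k)%N).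

Definition regconj f : quat R -> quat R := qpsum (fun n => qconj (coefs f n)).

Definition symmetrization f : quat R -> quat R := star f (regconj f).

Definition star_recip f : quat R -> quat R :=
  fun q => (symmetrization f q)^-1 * regconj f q.

Definition lin (a b : quat R) : quat R -> quat R := fun q => q * a + b.

(* For A = [[a, c], [b, d]], this is F_A(q) = (qc + d)^{-*} * (qa + b). *)
Definition moebius (A : 'M[quat R]_2) : quat R -> quat R :=
  star (star_recip (lin (A 0 1) (A 1 1))) (lin (A 0 0) (A 1 0)).

End SliceRegular.

Arguments unit_ball R _ : clear implicits.

Section Calculus.
Variables (R : realType) (m n : nat).

(* On an open set U, [Ck k U f] says that f is of class C^k on U. *)
Fixpoint Ck (k : nat) (U : set 'rV[R]_m) (f : 'rV[R]_m -> 'rV[R]_n) : Prop :=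
  if k is k'.+1 then
    (forall x, U x -> differentiable f x) /\
    (forall v, Ck k' U (fun x => 'd f x v))
  else forall x, U x -> {for x, continuous f}.

Definition smooth_on U f := forall k, Ck k U f.

End Calculus.

(* A chart of the set M: only the values of [cmap] on [cdom] matter. *)
Record chart (R : realType) (M : Type) (n : nat) :=
  Chart { cdom : set M; cmap : M -> 'rV[R]_n }.

Section Manifolds.
Variable R : realType.

Section Maps.
Variables (M N : Type) (m n : nat).
Variables (A : set (chart R M m)) (B : set (chart R N n)).
Implicit Types (f : M -> N) (c : chart R M m) (d : chart R N n).

Definition overlap f c d : set 'rV[R]_m :=
  cmap c @` (cdom c `&` f @^-1` cdom d).

(* g = d o f o c^-1 wherever the right-hand side makes sense *)
Definition coord_expr f c d (g : 'rV[R]_m -> 'rV[R]_n) : Prop :=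
  forall x, cdom c x -> cdom d (f x) -> g (cmap c x) = cmap d (f x).

(* The openness of the overlaps, with the continuity of the coordinate
   expressions, amounts to the continuity of f. *)
Definition smooth_map f : Prop :=
  forall c d, A c -> B d ->
    open (overlap f c d) /\
    exists2 g, coord_expr f c d g & smooth_on (overlap f c d) g.

Definition submersion f : Prop :=
  smooth_map f /\
  forall c d g x, A c -> B d -> coord_expr f c d g ->
    cdom c x -> cdom d (f x) -> set_surj setT setT ('d g (cmap c x)).

Definition immersion f : Prop :=
  smooth_map f /\
  forall c d g x, A c -> B d -> coord_expr f c d g ->
    cdom c x -> cdom d (f x) -> injective ('d g (cmap c x)).

End Maps.

Definition diffeomorphism (M N : Type) m n (A : set (chart R M m))
    (B : set (chart R N n)) (f : M -> N) : Prop :=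
  exists g : N -> M,
    [/\ cancel f g, cancel g f, smooth_map A B f & smooth_map B A g].

Section Atlas.
Variables (M : Type) (n : nat) (A : set (chart R M n)).

Definition atlas_open (W : set M) : Prop :=
  forall c, A c -> open (cmap c @` (cdom c `&` W)).

Definition atlas_hausdorff : Prop :=
  forall x y : M, x <> y -> exists U V : set M,
    [/\ atlas_open U, atlas_open V, U x, V y & U `&` V = set0].

Definition atlas_second_countable : Prop :=
  exists2 B : set (set M), countable B &
    (forall V, B V -> atlas_open V) /\
    (forall W x, atlas_open W -> W x -> exists V, [/\ B V, V x & V `<=` W]).

(* A is a smooth atlas, not necessarily maximal, whose topology is Hausdorff
   and second countable; the smoothness of the identity is the
   compatibility of any two charts of A. *)
Definition smooth_manifold : Prop :=
  [/\ (forall c, A c ->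
         {in cdom c &, injective (cmap c)} /\ open (cmap c @` cdom c)),
      (forall x, exists2 c, A c & cdom c x),
      smooth_map A A id,
      atlas_hausdorff & atlas_second_countable].

End Atlas.

Definition smooth_embedding (M N : Type) m n (A : set (chart R M m))
    (B : set (chart R N n)) (f : M -> N) : Prop :=
  [/\ immersion A B f, injective f &
      forall W, atlas_open A W ->
        exists2 V, atlas_open B V & W = f @^-1` V].

Definition euclidean_atlas (n : nat) : set (chart R 'rV[R]_n n) :=
  [set Chart setT id].

Definition ball_atlas : set (chart R (unit_ball R) 4) :=
  [set Chart setT (fun q => \val q : 'rV[R]_4)].

End Manifolds.

Definition image_proj (T U : Type) (f : T -> U) (x : T) : range f :=
  exist _ (f x) (mem_set (imageT f x)).

Section Groups.
Variable R : realType.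

Definition adjoint (A : 'M[quat R]_2) : 'M[quat R]_2 := map_mx (@qconj R) A^T.

Definition I11 : 'M[quat R]_2 := diag_mx (\row_j (if j == 0 then 1 else -1)).

Definition Sp11 : set 'M[quat R]_2 := [set A | adjoint A *m I11 *m A = I11].

(* The inclusion of Sp(1,1) in M_2(H), identified with R^16. *)
Definition Sp11_coords (A : Sp11) : 'rV[R]_16 :=
  row_mx (row_mx (\val A 0 0 : 'rV[R]_4) (\val A 0 1 : 'rV[R]_4))
         (row_mx (\val A 1 0 : 'rV[R]_4) (\val A 1 1 : 'rV[R]_4)).

Definition Sp1 : set (quat R) := [set u | qabs u = 1].

Definition Sp1_coset (A : Sp11) : set Sp11 :=
  [set B | exists2 u, Sp1 u & \val B = \val A *m u%:M].

Definition Sp11_quo : set (set Sp11) := range Sp1_coset.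

Definition Sp11_proj : Sp11 -> Sp11_quo := image_proj Sp1_coset.

(* The maps F_A, as self-maps of the unit ball: only the values of
   [moebius A] on the unit ball are used. *)
Definition Moeb : set (unit_ball R -> unit_ball R) :=
  [set F | exists2 A, Sp11 A & forall q, \val (F q) = moebius A (\val q)].

Lemma unit_ball0 : unit_ball R 0.
Proof.
by rewrite /unit_ball/= /qabs (eqP (_ : qsqn 0 == 0)) ?qsqn_eq0// sqrtr0.
Qed.

Definition ball_origin : unit_ball R := exist _ 0 (mem_set unit_ball0).

Definition Moeb0 : set Moeb := [set F | \val F ball_origin = ball_origin].

Definition Moeb_orbit (F : Moeb) : set Moeb :=
  [set G | exists2 F0, Moeb0 F0 & \val G = \val F0 \o \val F].

Definition Moeb_orbits : set (set Moeb) := range Moeb_orbit.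

Definition Moeb_proj : Moeb -> Moeb_orbits := image_proj Moeb_orbit.

(* This is F^-1(0): F is a bijection of the unit ball, so that the default
   value [id] of [pinv] plays no role. *)
Definition inv_orbit0 (F : Moeb) : unit_ball R :=
  'pinv_id [set: unit_ball R] (\val F) ball_origin.

End Groups.

Arguments Sp11 R _ : clear implicits.
Arguments Sp11_quo R _ : clear implicits.
Arguments Moeb R _ : clear implicits.
Arguments Moeb_orbits R _ : clear implicits.

(* Main.v *)
Require Import Defs.
From HB Require Import structures.
From mathcomp Require Import all_boot all_order all_algebra.
From mathcomp Require Import ring lra.
From mathcomp Require Import all_classical all_reals all_analysis.
Import numFieldNormedType.Exports.
Set Implicit Arguments.
Unset Strict Implicit.
Unset Printing Implicit Defensive.
Import Order.TTheory GRing.Theory Num.Theory.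
Local Open Scope classical_set_scope.
Local Open Scope ring_scope.

(** Why the theorem holds.

    Let A = [[a, c], [b, d]] be in Sp(1,1) and put w = - conj (d^-1 c), which
    lies in the ball. The regular reciprocal of q c + d has the power series
    sum_n q^n (conj w)^n d^-1, so that everything is governed by the kernel
    S = sum_n q^n (conj w)^n, the solution of S = 1 + q S (conj w)
    ([cvg_kernel], [moebiusE]). The relations defining Sp(1,1) turn the
    *-product into F_A(q) = (q S - S w) h with h = d^-1 a of modulus 1
    ([moebius_factor]). Two consequences carry the algebraic half. First, F_A
    vanishes exactly at w: if q S = S w, then S = 1 + |w|^2 S is real, hence
    central, and q = w ([moebius_eq0]). Secondly, S depends only on q and w, so
    two transformations with the same zero differ by right multiplication by a
    unit quaternion ([moebius_same_root]). The orbits are therefore the fibres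
    of F |-> F^-1(0) ([Moeb_orbitE]), and the induced map is a bijection: it is
    well defined and injective, and w is the value at F_{A^-1} for
    A = (1 - |w|^2)^(-1/2) [[1, conj w], [w, 1]] ([ball_sectionK]).

    For the smoothness, the zero of F_{A^-1} is b d^-1, a rational function of
    the real coordinates of A; it is thus a smooth function on Sp(1,1).
    Smoothness descends along submersions ([submersion_descent]), first to the
    quotient Sp(1,1) / Sp(1)I_2, hence to M(B), then to the orbit space. In the
    other direction, w |-> A above is smooth into the 2 x 2 quaternionic
    matrices, hence into the embedded submanifold Sp(1,1) ([embedding_lift]),
    and its composite with the projections is the inverse of the induced map.

    Descent and lifting rest on local sections of submersions and local left
    inverses of immersions, both consequences of the inverse function theorem
    at a point where the differential is the identity ([local_inverse]), which
    is proved by contraction. *)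

(** * Maps of class C^k between normed spaces *)

Section Diff.
Context {R : realType}.
Implicit Types V W : normedModType R.

(** The form in which a differential is verified by hand: an explicit bound
    on the error term instead of a little-o. *)
Lemma is_diff_epsP V W (f : V -> W) x (df : {linear V -> W}) : continuous df ->
  is_diff x f df <-> (forall e : R, 0 < e ->
    \forall h \near (0 : V), `|f (h + x) - f x - df h| <= e * `|h|).
Proof.
move=> cdf; split => [[dfx dfE]|H].
  move=> e e0; have /diff_locally/eqaddoP := dfx.
  move/(_ _ e0); apply: filterS => h /=.
  by rewrite dfE !fctE /= opprD addrA.
have E : f \o shift x = cst (f x) + df +o_ 0 id.
  apply/eqaddoP => e e0; apply: filterS (H e e0) => h /=.
  by rewrite !fctE /= opprD addrA.
have D : 'd f x = df :> (V -> W) by apply: diff_unique.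
by apply: DiffDef => //; apply/diff_locallyP; rewrite D.
Qed.

Lemma is_diff_near V W (f g : V -> W) x :
  (\near x, f x = g x) -> differentiable f x -> is_diff x g ('d f x).
Proof.
move=> fg df; have cdf := diff_continuous df.
apply/is_diff_epsP => // e e0.
have /(is_diff_epsP _ _ cdf)/(_ e e0) H := differentiableP df.
have fg' : \forall h \near (0 : V), f (h + x) = g (h + x).
  rewrite [\forall h \near 0, _](near_shift x) sub0r.
  by apply: filterS fg => h /=; rewrite subrK.
apply: filterS2 H fg' => h + <-.
by rewrite (nbhs_singleton fg).
Qed.

Lemma is_diff_differentiable V W (f : V -> W) x (df : V -> W) :
  is_diff x f df -> differentiable f x.
Proof. by case. Qed.

Lemma is_diffE V W (f : V -> W) x (df : V -> W) v :
  is_diff x f df -> 'd f x v = df v.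
Proof. by case=> _ <-. Qed.

End Diff.

Section CkNdef.
Variables (R : realType) (V W : normedModType R).

(** The recursion of [Ck], for maps between arbitrary normed modules: real
    valued functions such as coordinates, determinants and the squared modulus
    enter the computations ([CkNE] relates the two). *)
Fixpoint CkN (k : nat) (U : set V) (f : V -> W) : Prop :=
  if k is k'.+1 then
    (forall x, U x -> differentiable f x) /\
    (forall v, CkN k' U (fun x => 'd f x v))
  else forall x, U x -> {for x, continuous f}.

End CkNdef.

Section CkN.
Context {R : realType}.
Implicit Types V W : normedModType R.

Lemma CkNE m n k U (f : 'rV[R]_m -> 'rV[R]_n) : CkN k U f <-> Ck k U f.
Proof.
elim: k f => [//|k IH] f /=.
by split => -[df H]; split => // v; apply/IH.
Qed.

Lemma CkNS V W k U (f : V -> W) : CkN k.+1 U f -> CkN k U f.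
Proof.
elim: k f => [|k IH] f; first by move=> [df _] x /df /differentiable_continuous.
by move=> [df H]; split => // v; apply/IH/H.
Qed.

Lemma near_open V (U : set V) (x : V) (P : V -> Prop) :
  open U -> U x -> (forall y, U y -> P y) -> \near x, P x.
Proof. by move=> oU Ux UP; apply: filterS UP _; apply: open_nbhs_nbhs. Qed.

(** The class C^k is a local property, because functions that agree near a
    point have the same differential there; this allows each C^k claim to be
    checked on whichever expression is convenient. *)
Lemma CkN_local V W k U (f : V -> W) :
  (forall x, U x -> exists A, exists2 g, open A /\ A x &
     (forall y, A y -> g y = f y) /\ CkN k A g) -> CkN k U f.
Proof.
elim: k f U => [|k IH] f U H /=.
  move=> x /H[A [g [oA Ax] [gf cg]]].
  have : g y @[y --> x] --> g x := cg x Ax.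
  rewrite (gf _ Ax); apply: cvg_trans; apply: near_eq_cvg.
  by apply: (near_open oA Ax) => y /gf.
have Hd x : U x -> exists A, exists2 g, open A /\ A x &
    [/\ (forall y, A y -> g y = f y), CkN k.+1 A g &
        forall y, A y -> differentiable f y /\ 'd f y = 'd g y :> (V -> W)].
  move=> /H[A [g oAx [gf cg]]]; exists A, g; first exact: oAx.
  split; [exact: gf|exact: cg|move=> y Ay].
  have [df E] := is_diff_near (near_open oAx.1 Ay gf) (cg.1 y Ay).
  by split; [exact: df|exact: E].
split=> [x /Hd[A [g [_ Ax] [_ _ D]]]|v]; first exact: (D x Ax).1.
apply: IH => x /Hd[A [g oAx [gf [_ cg] D]]].
exists A, (fun y => 'd g y v); [exact: oAx|split; last exact: cg].
by move=> y Ay; exact: (esym (congr1 (@^~ v) (D y Ay).2)).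
Qed.

Lemma CkN_sub V W k (U A : set V) (f : V -> W) :
  A `<=` U -> CkN k U f -> CkN k A f.
Proof.
move=> AU; elim: k f => [|k IH] f /=; first by move=> + x /AU; apply.
by move=> [df H]; split => [x /AU/df//|v]; apply: IH.
Qed.

Lemma CkN_ext V W k (U : set V) (f g : V -> W) : open U ->
  (forall x, U x -> f x = g x) -> CkN k U f -> CkN k U g.
Proof. by move=> oU fg cf; apply: CkN_local => x Ux; exists U, f. Qed.

Lemma CkN_cst V W k (U : set V) (c : W) : CkN k U (cst c).
Proof.
elim: k c => [|k IH] c /=; first by move=> x _; exact: cvg_cst.
split => [x _|v]; first exact: differentiable_cst.
have -> : (fun x => 'd (@cst V W c) x v) = cst 0; last exact: IH.
by apply/funext => x; rewrite diff_cst.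
Qed.

Lemma CkN_linear V W k (U : set V) (f : {linear V -> W}) :
  continuous f -> CkN k U f.
Proof.
move=> cf; case: k => [|k] /=; first by move=> x _; exact: cf.
split => [x _|v]; first exact: linear_differentiable.
have -> : (fun x => 'd f x v) = cst (f v); last exact: CkN_cst.
by apply/funext => x; rewrite diff_lin.
Qed.

Lemma CkN_add V W k (U : set V) (f g : V -> W) : open U ->
  CkN k U f -> CkN k U g -> CkN k U (fun x => f x + g x).
Proof.
move=> oU; elim: k f g => [|k IH] f g /=.
  by move=> cf cg x Ux; apply: cvgD; [exact: cf|exact: cg].
move=> [df cf] [dg cg]; split => [x Ux|v].
  by apply: (@differentiableD _ _ _ f g); [exact: df|exact: dg].
apply: (CkN_ext oU _ (IH _ _ (cf v) (cg v))) => x Ux.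
exact: (esym (congr1 (@^~ v) (@diffD _ _ _ f g x (df x Ux) (dg x Ux)))).
Qed.

Lemma CkN_sum V W k (U : set V) (I : finType) (P : pred I) (f : I -> V -> W) :
  open U -> (forall i, P i -> CkN k U (f i)) ->
  CkN k U (fun x => \sum_(i | P i) f i x).
Proof.
move=> oU H; apply: (CkN_ext oU (f := fun x =>
  \sum_(i <- [seq i <- index_enum I | P i]) f i x)).
  by move=> x Ux; rewrite -[RHS]big_filter.
have : all P [seq i <- index_enum I | P i] by exact: filter_all.
elim: [seq _ <- _ | _] => [_|i s IH /= /andP[Pi /IH ch]].
  by apply: (CkN_ext oU _ (CkN_cst k U 0)) => x _; rewrite big_nil.
apply: (CkN_ext oU _ (CkN_add oU (H _ Pi) ch)) => x _.
by rewrite big_cons.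
Qed.

(** Leibniz rule: each derivation of B (f x) (g x) yields two terms of the
    same shape, so that one induction on k serves all products. *)
Lemma CkN_bilinear V W1 W2 W k (U : set V) (B : {bilinear W1 -> W2 -> W})
    (f : V -> W1) (g : V -> W2) : open U ->
  continuous (fun p => B p.1 p.2) ->
  CkN k U f -> CkN k U g -> CkN k U (fun x => B (f x) (g x)).
Proof.
move=> oU cB; elim: k f g => [|k IH] f g.
  move=> cf cg x Ux.
  have pfg : (f y, g y) @[y --> x] --> (f x, g x).
    by apply: cvg_pair; [exact: cf|exact: cg].
  exact: (cvg_comp _ _ pfg (cB (f x, g x))).
move=> Cf Cg; have [df cf] := Cf; have [dg cg] := Cg.
have D x : U x -> is_diff x (fun y => B (f y) (g y))
    (fun v => B (f x) ('d g x v) + B ('d f x v) (g x)).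
  move=> Ux.
  have dB : is_diff (f x, g x) (fun p => B p.1 p.2)
      (fun q => B (f x) q.2 + B q.1 (g x)).
    by apply: DiffDef; [exact: differentiable_bilin|rewrite diff_bilin].
  have dfg := is_diff_pair (differentiableP (df x Ux))
    (differentiableP (dg x Ux)).
  exact: (is_diff_comp dfg dB).
split=> [x Ux|v]; first exact: (is_diff_differentiable (D x Ux)).
apply: (CkN_ext oU (f := fun x => B (f x) ('d g x v) + B ('d f x v) (g x))).
  by move=> x Ux; exact: esym (is_diffE v (D x Ux)).
apply: (CkN_add oU); apply: IH.
- exact: CkNS.
- exact: cg.
- exact: cf.
- exact: CkNS.
Qed.

Lemma CkN_mul V k (U : set V) (f g : V -> R) : open U ->
  CkN k U f -> CkN k U g -> CkN k U (fun x => f x * g x).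
Proof. by move=> oU; apply: CkN_bilinear => // p; exact: mul_continuous. Qed.

Lemma scale_is_bilinear W : bilinear_for
  (GRing.Scale.Law.clone _ _ *:%R _) (GRing.Scale.Law.clone _ _ *:%R _)
  (@GRing.scale R W : R -> W -> W).
Proof.
split=> [u'|u] a x y /=; first by rewrite scalerDl scalerA.
by rewrite scalerDr !scalerA mulrC.
Qed.

HB.instance Definition _ W := bilinear_isBilinear.Build R R W W _ _
  (@GRing.scale R W : R -> W -> W) (@scale_is_bilinear W).

Lemma CkN_scale V W k (U : set V) (a : V -> R) (f : V -> W) : open U ->
  CkN k U a -> CkN k U f -> CkN k U (fun x => a x *: f x).
Proof.
move=> oU.
apply: (@CkN_bilinear _ _ _ _ _ _ (@GRing.scale R W : R -> W -> W)) => // p.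
exact: scale_continuous.
Qed.

Lemma CkN_complin V W W' k (U : set V) (L : {linear W -> W'}) (f : V -> W) :
  open U -> continuous L -> CkN k U f -> CkN k U (fun x => L (f x)).
Proof.
move=> oU cL; elim: k f => [|k IH] f.
  by move=> cf x Ux; apply: (@cvg_comp _ _ _ f L); [exact: cf|exact: cL].
move=> [df cf]; split => [x Ux|v].
  by apply: (@differentiable_comp _ _ _ _ f L);
    [exact: df|exact: linear_differentiable].
apply: (CkN_ext oU _ (IH _ (cf v))) => x Ux.
rewrite (@diff_comp _ _ _ _ f L) ?diff_lin//; first exact: df.
exact: linear_differentiable.
Qed.

Definition mxcoord m n (i : 'I_m) (j : 'I_n) (M : 'M[R]_(m, n)) : R := M i j.

Lemma mxcoord_is_linear m n i j : linear (@mxcoord m n i j).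
Proof. by move=> x M N; rewrite /mxcoord !mxE. Qed.

HB.instance Definition _ m n i j :=
  GRing.isLinear.Build R 'M[R]_(m, n) R _ _ (@mxcoord_is_linear m n i j).

Lemma CkN_coord V m n k (U : set V) (f : V -> 'M[R]_(m, n)) i j : open U ->
  CkN k U f -> CkN k U (fun x => f x i j : R).
Proof.
move=> oU; apply: (@CkN_complin _ _ _ _ _ (mxcoord i j)) => //.
exact: coord_continuous.
Qed.

Lemma CkN_mx V m n k (U : set V) (f : V -> 'M[R]_(m, n)) : open U ->
  (forall i j, CkN k U (fun x => f x i j : R)) -> CkN k U f.
Proof.
move=> oU H; apply: (CkN_ext oU (f := fun x =>
  \sum_i \sum_j f x i j *: delta_mx i j)).
  by move=> x _; rewrite [RHS]matrix_sum_delta.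
apply: CkN_sum => // i _; apply: CkN_sum => // j _.
by apply: CkN_scale => //; exact: CkN_cst.
Qed.

(** The direction 'd f x v in which g is differentiated varies with x.
    Expanding it in the canonical basis leaves differentials of g in the fixed
    directions e_i, to which the induction hypothesis applies; this is where
    the intermediate space has to be finite dimensional. *)
Lemma CkN_comp V W m k (U : set V) (A : set 'rV[R]_m) (f : V -> 'rV[R]_m)
    (g : 'rV[R]_m -> W) : open U -> open A ->
  (forall x, U x -> A (f x)) ->
  CkN k U f -> CkN k A g -> CkN k U (fun x => g (f x)).
Proof.
move=> oU oA fUA; elim: k f g fUA => [|k IH] f g fUA.
  move=> cf cg x Ux; apply: (@cvg_comp _ _ _ f g); first exact: cf.
  exact/cg/fUA.
move=> Cf Cg; have [df cf] := Cf; have [dg cg] := Cg.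
split=> [x Ux|v].
  by apply: (@differentiable_comp _ _ _ _ f g); [exact: df|exact/dg/fUA].
apply: (CkN_ext oU (f := fun x => \sum_i
    ('d f x v 0 i) *: 'd g (f x) (delta_mx 0 i))).
  move=> x Ux; rewrite (@diff_comp _ _ _ _ f g); [|exact: df|exact/dg/fUA].
  rewrite /= [in RHS](row_sum_delta ('d f x v)) linear_sum.
  by apply: eq_bigr => i _; rewrite linearZ.
apply: CkN_sum => // i _; apply: CkN_scale => //.
  exact/CkN_coord/cf.
by apply: (IH f (fun z => 'd g z (delta_mx 0 i)) fUA); [exact: CkNS|exact: cg].
Qed.

(** Induction on k, as d(1/f) = - (1/f)^2 df only involves 1/f itself. *)
Lemma CkN_inv V k (U : set V) (f : V -> R) : open U ->
  (forall x, U x -> f x != 0) -> CkN k U f -> CkN k U (fun x => (f x)^-1).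
Proof.
move=> oU f0; elim: k => [|k IH].
  by move=> cf x Ux; apply: cvgV; [exact: f0|exact: cf].
move=> Cf; have [df cf] := Cf.
split=> [x Ux|v]; first exact: (@differentiableV _ _ f x (df x Ux) (f0 x Ux)).
have I := IH (CkNS Cf).
apply: (CkN_ext oU (f := fun x => (-1 * ((f x)^-1 * (f x)^-1)) * 'd f x v)).
  move=> x Ux; apply: esym.
  apply: eq_trans (congr1 (@^~ v) (@diffV _ _ f x (df x Ux) (f0 x Ux))) _.
  rewrite /= -[_ *: _]/(_ * _); congr (_ * _).
  by rewrite mulN1r expr2 invfM.
by do ?apply: CkN_mul => //; [exact: CkN_cst|exact: cf].
Qed.

End CkN.

(** * The inverse function theorem *)

(** Completeness is what Banach's fixed point theorem asks of row vectors in
    [ball_image_open]. *)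
HB.instance Definition _ (R : realType) (m n : nat) := Complete.on 'M[R]_(m, n).

Section MatrixNorm.
Context {R : realType} {m n : nat}.
Implicit Types A : 'M[R]_(m, n).

Lemma coord_le_norm A i j : `|A i j| <= `|A|.
Proof. by rewrite [leRHS]/Num.Def.normr/= mx_normrE (le_bigmax _ _ (i, j)). Qed.

Lemma norm_le_coord A (K : R) :
  0 <= K -> (forall i j, `|A i j| <= K) -> `|A| <= K.
Proof.
move=> K0 AK; rewrite [leLHS]/Num.Def.normr/= mx_normrE.
by apply: bigmax_le => // -[i j] _; exact: AK.
Qed.

Lemma is_diff_coord A i j :
  is_diff A (fun N : 'M[R]_(m, n) => N i j : R) (fun N => N i j).
Proof.
apply: DiffDef; first exact: differentiable_coord.
by apply: (@diff_lin _ _ _ (mxcoord i j)); exact: coord_continuous.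
Qed.

End MatrixNorm.

Section MeanValue.
Context {R : realType} {V : normedModType R} {n : nat}.

(** For the sup norm it suffices to bound each coordinate, to which the real
    mean value theorem applies along the segment from y to x; the segment
    stays in the ball by convexity. *)
Lemma mean_value_ineq (f : V -> 'rV[R]_n) (x0 : V) (r K : R) : 0 <= K ->
  (forall x, ball x0 r x ->
     differentiable f x /\ forall v, `|'d f x v| <= K * `|v|) ->
  forall x y, ball x0 r x -> ball x0 r y -> `|f x - f y| <= K * `|x - y|.
Proof.
move=> K0 H x y Bx By.
apply: norm_le_coord => [|i j]; first by rewrite mulr_ge0.
pose g (t : R) : V := t *: (x - y) + y.
have gB (t : R) : t \in `[0, 1] -> ball x0 r (g t).
  rewrite in_itv /= => /andP[t0 t1]; rewrite -ball_normE /=.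
  have -> : x0 - g t = t *: (x0 - x) + (1 - t) *: (x0 - y).
    rewrite scalerBl scale1r addrCA -scalerBr.
    have -> : x0 - x - (x0 - y) = - (x - y) by rewrite !opprB addrC subrKA.
    by rewrite scalerN /g opprD addrCA addrC.
  move: Bx By; rewrite -!ball_normE /= => Bx By.
  apply: le_lt_trans (ler_normD _ _) _.
  rewrite !normrZ ger0_norm// ger0_norm ?subr_ge0//.
  rewrite -subr_gt0 in Bx; rewrite -subr_gt0 in By.
  have [->|t_neq0] := eqVneq t 0; first by lra.
  have t_gt0 : 0 < t by rewrite lt_def t_neq0.
  have := mulr_gt0 t_gt0 Bx.
  have : 0 <= (1 - t) * (r - `|x0 - y|).
    by rewrite mulr_ge0 ?subr_ge0// ltW// -subr_gt0.
  lra.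
have dg t : is_diff t g (fun s => s *: (x - y)).
  have := is_diffD (is_diff_scalel t (x - y)) (is_diff_cst y t).
  by move/is_diff_eq; apply; apply/funext => s; rewrite fctE addr0.
pose phi (t : R) : R := f (g t) i j.
pose dphi (t : R) : R := 'd f (g t) (x - y) i j.
have df (t : R) : t \in `[0, 1] -> is_derive t 1 phi (dphi t).
  move=> /gB/H[dfg _].
  have D := is_diff_comp (is_diff_comp (dg t) (differentiableP dfg))
    (is_diff_coord (f (g t)) i j).
  have Dd := is_diff_differentiable D.
  apply: DeriveDef; first exact: diff_derivable.
  by rewrite deriveE// (is_diffE _ D) /= scale1r.
have cphi : {within `[0, 1], continuous phi}.
  apply: derivable_within_continuous => t /df dft.
  exact: (@ex_derive _ _ _ _ _ _ _ dft).
have df' (t : R) : t \in `]0, 1[ -> is_derive t 1 phi (dphi t).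
  by move=> t01; apply: df; exact: subset_itv_oo_cc.
have [c c01] := MVT_segment ler01 df' cphi.
rewrite subr0 mulr1 /phi /g scale1r subrK scale0r add0r !mxE => ->.
exact: le_trans (coord_le_norm _ _ _) ((H _ (gB _ c01)).2 _).
Qed.

End MeanValue.

Section LocalInverse.
Context {R : realType} {n : nat}.
Implicit Types (U : set 'rV[R]_n) (g : 'rV[R]_n -> 'rV[R]_n).

(** Each of the n partial derivatives is continuous, hence close to e_i near
    x0; linearity turns this into a bound on the operator norm of id - dg. *)
Lemma norm_diff_near_id U g x0 : open U -> U x0 -> CkN 1 U g ->
  (forall v, 'd g x0 v = v) ->
  \forall x \near x0, U x /\ forall v, `|v - 'd g x v| <= 2^-1 * `|v|.
Proof.
move=> oU Ux0 [dg cg] g0.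
(* n.+1 rather than n: the bound must also be positive in dimension 0 *)
have e0 : 0 < (2 * n.+1%:R)^-1 :> R by rewrite invr_gt0 mulr_gt0.
have near_e : \forall x \near x0, forall i : 'I_n,
    `|delta_mx 0 i - 'd g x (delta_mx 0 i)| <= (2 * n.+1%:R)^-1.
  apply: (@filter_forall _ _ (fun i x =>
    `|delta_mx 0 i - 'd g x (delta_mx 0 i)| <= (2 * n.+1%:R)^-1) _
    (nbhs_filter x0)) => i.
  pose e : 'rV[R]_n := delta_mx 0 i.
  have c : 'd g x e @[x --> x0] --> e.
    exact: (eq_ind _ (fun z => 'd g x e @[x --> x0] --> z)
      (cg e x0 Ux0) _ (g0 e)).
  by move/cvgrPdist_le: c; apply.
have nU : \forall x \near x0, U x by apply: (near_open oU Ux0).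
apply: filterS2 nU near_e => x Ux He; split => // v.
have -> : v - 'd g x v = \sum_i v 0 i *: (delta_mx 0 i - 'd g x (delta_mx 0 i)).
  rewrite {1 2}(row_sum_delta v) linear_sum -sumrB; apply: eq_bigr => i _.
  by rewrite linearZ scalerBr.
apply: le_trans (ler_norm_sum _ _ _) _.
apply: (@le_trans _ _ (\sum_(i < n) `|v| * (2 * n.+1%:R)^-1)).
  by apply: ler_sum => i _; rewrite normrZ ler_pM// coord_le_norm.
rewrite sumr_const card_ord -mulrnAr mulrC ler_wpM2r//.
rewrite -mulr_natr invfM -mulrA ler_piMr ?invr_ge0//.
by rewrite ler_pdivrMl ?ltr0n// mulr1 ler_nat.
Qed.

(** By the mean value inequality, id - g is a contraction near x0, which
    yields the injectivity of g and the openness of its images; on the same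
    ball the bound on the differential keeps it invertible. *)
Lemma near_id_lipschitz U g x0 : open U -> U x0 -> CkN 1 U g ->
  (forall v, 'd g x0 v = v) -> exists2 r : R, 0 < r &
  (forall x, ball x0 r x -> U x /\ forall v, `|v - 'd g x v| <= 2^-1 * `|v|) /\
  forall x y, ball x0 r x -> ball x0 r y ->
    `|(x - g x) - (y - g y)| <= 2^-1 * `|x - y|.
Proof.
move=> oU Ux0 cg g0.
have /nbhs_ballP[r /= r0 Hr] := norm_diff_near_id oU Ux0 cg g0.
exists r => //; split=> [x /Hr//|].
apply: (@mean_value_ineq _ _ _ (fun x => x - g x)) => [|x /Hr[Ux Dx]].
  by rewrite invr_ge0.
have D := is_diffB (is_diff_id x) (differentiableP (cg.1 x Ux)).
split; first exact: (is_diff_differentiable D).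
move=> v; rewrite (is_diffE v D).
exact: Dx.
Qed.

(** A preimage of y near g x is a fixed point of z |-> z - g z + y, which
    contracts and maps a small closed ball around x into itself. *)
Lemma ball_image_open (g : 'rV[R]_n -> 'rV[R]_n) x0 r :
  (forall x y, ball x0 r x -> ball x0 r y ->
    `|(x - g x) - (y - g y)| <= 2^-1 * `|x - y|) ->
  open (g @` ball x0 r).
Proof.
move=> H; rewrite openE => _ [x Bx <-].
have /nbhs_closedballP[s sB] : nbhs x (ball x0 r).
  by apply: open_nbhs_nbhs; split => //; exact: ball_open.
have s0 : 0 < s%:num by [].
have hs0 : 0 < s%:num / 2 by rewrite divr_gt0.
apply/nbhs_ballP; exists (s%:num / 2) => // y xy.
rewrite -ball_normE /= in xy.
have cbE z : closed_ball x s%:num z <-> `|x - z| <= s%:num.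
  by rewrite closed_ballE.
pose T z := z - g z + y.
have TS : set_fun (closed_ball x s%:num) (closed_ball x s%:num) T.
  move=> z Sz; apply/cbE; have /cbE xz := Sz.
  have -> : x - T z = ((x - g x) - (z - g z)) + (g x - y).
    by rewrite /T [RHS]addrA [_ + g x]addrAC subrK [in LHS]opprD addrA.
  rewrite (splitr s%:num); apply: le_trans (ler_normD _ _) _; apply: lerD.
    apply: le_trans (H _ _ Bx (sB _ Sz)) _.
    by rewrite mulrC ler_wpM2r// invr_ge0.
  exact: ltW.
pose TF : {fun closed_ball x s%:num >-> closed_ball x s%:num} :=
  HB.pack T (isFun.Build _ _ _ _ T TS).
have cT : is_contraction TF.
  exists (2^-1)%:nng; split => /=; first by rewrite invf_lt1// ltr1n.
  move=> [z z'] [/= /sB Bz /sB Bz'].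
  by rewrite /T opprD addrACA subrr addr0; exact: H.
have [||p Sp Ep] := banach_fixed_point cT.
- exact: closed_ball_closed.
- by exists x; exact: closed_ballxx.
exists p; first exact: sB.
move: Ep; rewrite /= /T -addrA => /eqP.
by rewrite -subr_eq0 opprD addrA subrr sub0r oppr_eq0 addrC subr_eq0 => /eqP.
Qed.

(** A linear map is a finite sum of coordinates times fixed vectors. *)
Lemma rV_linear_continuous (W : normedModType R) (f : {linear 'rV[R]_n -> W}) :
  continuous f.
Proof.
have H : CkN 0 [set: 'rV[R]_n] f.
  apply: (CkN_ext openT (f := fun v : 'rV[R]_n =>
    \sum_i v 0 i *: f (delta_mx 0 i))).
    move=> v _; rewrite [in RHS](row_sum_delta v) linear_sum.
    by apply: eq_bigr => i _; rewrite linearZ.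
  apply: CkN_sum => [|i _]; first exact: openT.
  apply: CkN_scale; [exact: openT| |exact: CkN_cst].
  by apply: (@CkN_linear _ _ _ _ _ (mxcoord 0 i)); exact: coord_continuous.
by move=> v; exact: H.
Qed.

End LocalInverse.

Section CkNMatrix.
Context {R : realType} {V : normedModType R} (k : nat) (U : set V).
Hypothesis oU : open U.

Lemma CkN_prod (I : Type) (s : seq I) (P : pred I) (f : I -> V -> R) :
  (forall i, CkN k U (f i)) -> CkN k U (fun x => \prod_(i <- s | P i) f i x).
Proof.
move=> H; elim: s => [|i s IH].
  by apply: (CkN_ext oU _ (CkN_cst k U (1 : R))) => x _; rewrite big_nil.
case: (boolP (P i)) => Pi.
  apply: (CkN_ext oU _ (CkN_mul oU (H i) IH)) => x _.
  by rewrite big_cons Pi.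
by apply: (CkN_ext oU _ IH) => x _; rewrite big_cons (negbTE Pi).
Qed.

Lemma CkN_det n (A : V -> 'M[R]_n) :
  (forall i j, CkN k U (fun x => A x i j)) -> CkN k U (fun x => \det (A x)).
Proof.
move=> H; apply: CkN_sum => // s _; apply: CkN_mul => //; first exact: CkN_cst.
exact: CkN_prod.
Qed.

Lemma CkN_invmx n (A : V -> 'M[R]_n) : (forall x, U x -> A x \in unitmx) ->
  (forall i j, CkN k U (fun x => A x i j)) ->
  forall i j, CkN k U (fun x => invmx (A x) i j).
Proof.
move=> uA H i j.
apply: (CkN_ext oU (f := fun x => (\det (A x))^-1 * cofactor (A x) j i)).
  by move=> x Ux; rewrite /invmx (uA x Ux) !mxE.
apply: CkN_mul => //.
  apply: CkN_inv => //; last exact: CkN_det.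
  by move=> x /uA; rewrite unitmxE unitfE.
apply: CkN_mul => //; first exact: CkN_cst.
apply: CkN_det => a b.
by apply: (CkN_ext oU (f := fun x => A x (lift j a) (lift i b))) => // x _;
  rewrite !mxE.
Qed.

End CkNMatrix.

Section LocalInverseTheorem.
Context {R : realType} {n : nat}.
Implicit Types (U : set 'rV[R]_n) (g : 'rV[R]_n -> 'rV[R]_n).

Lemma diff_jacobian m (f : 'rV[R]_n -> 'rV[R]_m) x v :
  'd f x v = v *m jacobian f x.
Proof. by rewrite /jacobian mul_rV_lin1. Qed.

Lemma CkN_jacobian m (f : 'rV[R]_n -> 'rV[R]_m) k U : open U -> CkN k.+1 U f ->
  forall i j, CkN k U (fun x => jacobian f x i j).
Proof.
move=> oU [_ H] i j.
apply: (CkN_ext oU (f := fun x => 'd f x (delta_mx 0 i) 0 j)).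
  by move=> x _; rewrite !mxE.
exact: (CkN_coord 0 j oU (H (delta_mx 0 i))).
Qed.

(** Let z - x = h (g x + k) - h (g x) and let J be the Jacobian at x. Then
    k = (z - x) J + o(z - x), and o(z - x) is also o(k) by the Lipschitz bound
    on h; applying J^-1 gives z - x = k J^-1 + o(k). *)
Lemma is_diff_inverse g h (B : set 'rV[R]_n) x :
  open (g @` B) -> B x -> (forall z, B z -> h (g z) = z) ->
  (forall z, B z -> `|z - x| <= 2 * `|g z - g x|) ->
  differentiable g x -> jacobian g x \in unitmx ->
  is_diff (g x) h (mulmxr (invmx (jacobian g x))).
Proof.
move=> oB Bx hg gl dg uJ.
pose L : {linear 'rV[R]_n -> 'rV[R]_n} := mulmxr (invmx (jacobian g x)).
suff : is_diff (g x) h L by [].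
have cL : continuous L by exact: rV_linear_continuous.
apply/(is_diff_epsP _ _ cL) => e e0.
(* the error is first multiplied by |J^-1| <= C, then by |z - x| <= 2 |k| *)
have [C C0 LC] := linear_lipschitz cL.
have e'0 : 0 < e / (2 * C) by rewrite divr_gt0// mulr_gt0.
have /(is_diff_epsP _ _ (diff_continuous dg))/(_ _ e'0) := differentiableP dg.
move=> /nbhs_ballP[s /= s0 Hs].
have nB : \forall k \near (0 : 'rV[R]_n), (g @` B) (k + g x).
  rewrite [\forall k \near 0, _](near_shift (g x)) sub0r.
  apply: (near_open oB); first by exists x.
  by move=> y By /=; rewrite subrK.
have ns : \forall k \near (0 : 'rV[R]_n), `|k| < s / 2.
  apply/nbhs_ballP; exists (s / 2) => /=; first by rewrite divr_gt0.
  by move=> k; rewrite -ball_normE /= sub0r normrN.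
apply: filterS2 nB ns => k [z Bz gz] ks.
rewrite -gz !hg//.
have kE : k = g z - g x by rewrite gz addrK.
have zk : `|z - x| <= 2 * `|k| by rewrite kE; exact: gl.
have zs : ball 0 s (z - x).
  rewrite -ball_normE /= sub0r normrN; apply: le_lt_trans zk _.
  by rewrite mulrC -ltr_pdivlMr.
have := Hs _ zs; rewrite /= subrK -kE => Hz.
have -> : z - x - L k = - L (k - 'd g x (z - x)).
  rewrite (linearB L) opprB; congr (_ - _).
  by rewrite diff_jacobian /L /mulmxr /= mulmxK.
rewrite normrN; apply: le_trans (LC _) _.
apply: (@le_trans _ _ (C * (e / (2 * C) * (2 * `|k|)))).
  rewrite ler_wpM2l ?(ltW C0)//; apply: le_trans Hz _.
  by rewrite ler_wpM2l// ltW.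
by rewrite le_eqVlt; apply/orP; left; apply/eqP; field; rewrite gt_eqF.
Qed.

(** Inverse function theorem, at a point where the differential is the
    identity; [local_section] and [local_left_inverse] reduce to this case by
    composing with a linear map. As 'd h y is the inverse of the Jacobian of g
    at h y, it is as regular as h is, and h gains one derivative at each
    step. *)
Theorem local_inverse U g x0 : open U -> U x0 -> (forall k, CkN k U g) ->
  (forall v, 'd g x0 v = v) ->
  exists V h, [/\ open V /\ V x0, V `<=` U, open (g @` V),
    forall x, V x -> h (g x) = x & forall k, CkN k (g @` V) h].
Proof.
move=> oU Ux0 cg g0.
have [r r0 [B1 B2]] := near_id_lipschitz oU Ux0 (cg 1%N) g0.
pose V := ball x0 r.
(* id - g at least halves distances, so g at most halves them *)
have BL x y : V x -> V y -> `|x - y| <= 2 * `|g x - g y|.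
  move=> Vx Vy; have H := B2 _ _ Vx Vy.
  have E : x - y = ((x - g x) - (y - g y)) + (g x - g y).
    have -> : (x - g x) - (y - g y) = (x - y) - (g x - g y).
      by rewrite !opprD addrACA.
    by rewrite subrK.
  have : `|x - y| <= 2^-1 * `|x - y| + `|g x - g y|.
    by rewrite {1}E; apply: le_trans (ler_normD _ _) _; rewrite lerD2r.
  lra.
pose h y := xget x0 [set x | V x /\ g x = y].
have hP x : V x -> V (h (g x)) /\ g (h (g x)) = g x.
  by move=> Vx; apply: (xgetPex x0 (P := [set z | V z /\ g z = g x])); exists x.
have hK x : V x -> h (g x) = x.
  move=> Vx; have [Vh gh] := hP x Vx; have := BL _ _ Vh Vx.
  by rewrite gh subrr normr0 mulr0 normr_le0 subr_eq0 => /eqP.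
have oV : open (g @` V) by exact: ball_image_open.
have VU x : V x -> U x by move=> /B1[].
have oB : open V by exact: ball_open.
have dg x : V x -> differentiable g x by move=> /VU; exact: (cg 1%N).1.
have uJ x : V x -> jacobian g x \in unitmx.
  move=> Vx; rewrite -row_free_unit; apply: inj_row_free => v vJ.
  have := (B1 x Vx).2 v; rewrite diff_jacobian vJ subr0 => vv.
  apply/eqP; rewrite -normr_le0; lra.
have D x : V x -> is_diff (g x) h (mulmxr (invmx (jacobian g x))).
  move=> Vx; apply: (is_diff_inverse oV Vx hK _ (dg x Vx) (uJ x Vx)).
  by move=> z Vz; exact: BL.
exists V, h; split => //; first by split=> //; exact: ballxx.
have hV y : (g @` V) y -> V (h y) by move=> [x Vx <-]; exact: (hP x Vx).1.
have dh y : (g @` V) y -> differentiable h y.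
  by move=> [x Vx <-]; exact: (is_diff_differentiable (D x Vx)).
elim=> [y /dh|k IH]; first exact: differentiable_continuous.
split=> // v.
apply: (CkN_ext oV (f := fun y => v *m invmx (jacobian g (h y)))).
  move=> _ [x Vx <-].
  apply: eq_trans (congr1 (fun z => v *m invmx (jacobian g z)) (hK x Vx)) _.
  exact: (esym (is_diffE v (D x Vx))).
apply: (CkN_comp (g := fun z => v *m invmx (jacobian g z)) oV oB hV IH).
apply: CkN_mx => // i j.
apply: (CkN_ext oB (f := fun z => \sum_l v i l * invmx (jacobian g z) l j)).
  by move=> z _; rewrite !mxE.
apply: CkN_sum => // l _; apply: CkN_mul => //; first exact: CkN_cst.
apply: CkN_invmx => // a b; apply: CkN_jacobian => //.
by apply: CkN_sub (cg k.+1) => x /VU.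
Qed.

End LocalInverseTheorem.

(** * Smooth maps between manifolds *)

Section SmoothOn.
Context {R : realType}.

Lemma smooth_onE m n (U : set 'rV[R]_m) (f : 'rV[R]_m -> 'rV[R]_n) :
  smooth_on U f <-> forall k, CkN k U f.
Proof. by split=> H k; apply/CkNE/H. Qed.

Lemma smooth_on_local m n (U : set 'rV[R]_m) (f : 'rV[R]_m -> 'rV[R]_n) :
  (forall x, U x -> exists A, exists2 g, open A /\ A x &
     (forall y, A y -> g y = f y) /\ smooth_on A g) -> smooth_on U f.
Proof.
move=> H; apply/smooth_onE => k; apply: CkN_local => x /H[A [g oA [gf sg]]].
exists A, g => //; split=> //; exact: ((smooth_onE _ _).1 sg).
Qed.

Lemma smooth_on_sub m n (U A : set 'rV[R]_m) (f : 'rV[R]_m -> 'rV[R]_n) :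
  A `<=` U -> smooth_on U f -> smooth_on A f.
Proof.
by move=> AU /smooth_onE sf; apply/smooth_onE => k; apply: CkN_sub (sf k).
Qed.

Lemma smooth_on_comp m n p (U : set 'rV[R]_m) (A : set 'rV[R]_n)
    (f : 'rV[R]_m -> 'rV[R]_n) (g : 'rV[R]_n -> 'rV[R]_p) :
  open U -> open A -> (forall x, U x -> A (f x)) ->
  smooth_on U f -> smooth_on A g -> smooth_on U (g \o f).
Proof.
move=> oU oA fUA /smooth_onE sf /smooth_onE sg; apply/smooth_onE => k.
exact: (CkN_comp oU oA fUA).
Qed.

Lemma smooth_on_id m (U : set 'rV[R]_m) : smooth_on U id.
Proof.
apply/smooth_onE => k.
by apply: (@CkN_linear _ _ _ _ _ (idfun : {linear 'rV[R]_m -> 'rV[R]_m})) => x.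
Qed.

Lemma smooth_on_preimage_open m n (U : set 'rV[R]_m) (A : set 'rV[R]_n)
    (f : 'rV[R]_m -> 'rV[R]_n) :
  open U -> open A -> smooth_on U f -> open (U `&` f @^-1` A).
Proof.
move=> oU oA sf; rewrite openE => x [Ux Afx].
apply: filterI; first exact: open_nbhs_nbhs.
by apply: (sf 0%N x Ux); exact: open_nbhs_nbhs.
Qed.

End SmoothOn.

Section Charts.
Context {R : realType}.

Definition smooth_atlas (M : Type) m (A : set (chart R M m)) : Prop :=
  [/\ (forall c, A c ->
         {in cdom c &, injective (cmap c)} /\ open (cmap c @` cdom c)),
      (forall x, exists2 c, A c & cdom c x) & smooth_map A A id].

Lemma smooth_manifold_atlas (M : Type) m (A : set (chart R M m)) :
  smooth_manifold A -> smooth_atlas A.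
Proof. by case. Qed.

Lemma cmap_inj (M : Type) m (A : set (chart R M m)) c x y : smooth_atlas A ->
  A c -> cdom c x -> cdom c y -> cmap c x = cmap c y -> x = y.
Proof.
move=> [H _ _] Ac cx cy; have [inj _] := H _ Ac.
by apply: inj; exact: mem_set.
Qed.

Section SmoothAt.
Variables (M N : Type) (m n : nat).
Variables (A : set (chart R M m)) (B : set (chart R N n)).

(** Smoothness of f near x read in a single pair of charts, on an
    open set W of coordinates that f maps into the domain of the second
    chart. *)
Definition smooth_at (f : M -> N) (x : M) : Prop :=
  exists c d W g,
    [/\ A c /\ B d, cdom c x /\ W (cmap c x), open W /\ W `<=` cmap c @` cdom c,
        (forall y, cdom c y -> W (cmap c y) ->
           cdom d (f y) /\ g (cmap c y) = cmap d (f y)) & smooth_on W g].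

Hypotheses (hA : smooth_atlas A) (hB : smooth_atlas B).

Lemma overlapP (f : M -> N) c (d : chart R N n) x : A c -> cdom c x ->
  overlap f c d (cmap c x) -> cdom d (f x).
Proof.
move=> Ac cx [y [cy dy] E].
by rewrite -(cmap_inj hA Ac cy cx E).
Qed.

(** In other charts the coordinate expression is r o g o t, where t and r are
    changes of charts, and these are smooth. Hence smoothness around each point
    may be checked in whichever charts are at hand. *)
Lemma smooth_map_local (f : M -> N) :
  (forall x, smooth_at f x) -> smooth_map A B f.
Proof.
move=> H c' d' Ac' Bd'.
have loc p : overlap f c' d' p -> exists V G, [/\ open V /\ V p,
    V `<=` overlap f c' d', smooth_on V G &
    forall x, cdom c' x -> V (cmap c' x) -> G (cmap c' x) = cmap d' (f x)].
  move=> [x [c'x d'fx] <-{p}].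
  have [c [d [W [g [[Ac Bd] [cx Wx] [oW _] gE sg]]]]] := H x.
  have [_ _ /(_ _ _ Ac' Ac)[oO1 [t tE st]]] := hA.
  have [_ _ /(_ _ _ Bd Bd')[oO2 [r rE sr]]] := hB.
  set O1 := overlap id c' c in oO1 st; set O2 := overlap id d d' in oO2 sr.
  (* t : from c' to c and r : from d to d' are changes of charts *)
  pose V1 := O1 `&` t @^-1` W.
  have oV1 : open V1 by exact: smooth_on_preimage_open.
  have sgt : smooth_on V1 (g \o t).
    apply: (smooth_on_comp oV1 oW) => // [y []//|].
    by apply: smooth_on_sub st => y [].
  pose V := V1 `&` (g \o t) @^-1` O2.
  have oV : open V by exact: smooth_on_preimage_open.
  have VP y : cdom c' y -> V (cmap c' y) ->
      cdom d' (f y) /\ (r \o (g \o t)) (cmap c' y) = cmap d' (f y).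
    move=> c'y [[[z [c'z cz] E] Wy] O2y].
    have zy : z = y by exact: (cmap_inj hA Ac' c'z c'y E).
    rewrite zy /= in cz; rewrite /= (tE _ c'y cz) in Wy O2y *.
    have [dfy gy] := gE _ cz Wy; rewrite gy in O2y *.
    have d'fy : cdom d' (f y).
      by case: O2y => w [dw d'w] /(cmap_inj hB Bd dw dfy) <-.
    by split => //; exact: rE.
  exists V, (r \o (g \o t)); split.
  - split=> //; split.
      by split; [exists x|rewrite /= (tE _ c'x cx)].
    rewrite /= (tE _ c'x cx); have [dfx ->] := gE _ cx Wx.
    by exists (f x).
  - move=> y Vy; have [z [c'z _] E] := Vy.1.1.
    by exists z => //; split => //; apply: (VP z _ _).1; rewrite // E.
  - apply: (smooth_on_comp oV oO2) => // [y []//|].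
    by apply: smooth_on_sub sgt => y [].
  - by move=> y c'y Vy; exact: (VP y c'y Vy).2.
split.
  rewrite openE => p /loc[V [G [[oV Vp] VO _ _]]].
  by apply: (filterS VO); exact: open_nbhs_nbhs.
(* charts being injective, gg does not depend on the choice of x, and it is a
   coordinate expression on the whole overlap *)
pose gg p := xget 0 [set q | exists x,
  [/\ cdom c' x, cdom d' (f x), cmap c' x = p & q = cmap d' (f x)]].
have ggE : coord_expr f c' d' gg.
  move=> x c'x d'fx; rewrite /gg.
  case: xgetP => [q _ [y [c'y d'fy E ->]]|/(_ (cmap d' (f x)))[]].
    by rewrite (cmap_inj hA Ac' c'y c'x E).
  by exists x.
exists gg => //; apply: smooth_on_local => p Op.
have [V [G [[oV Vp] VO sG GE]]] := loc p Op.
exists V, G => //; split=> // y Vy.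
have [x [c'x d'fx] E] := VO _ Vy; rewrite -E in Vy *.
by rewrite (GE _ c'x Vy) (ggE _ c'x d'fx).
Qed.

End SmoothAt.

Section SmoothComp.
Variables (M N P : Type) (m n p : nat).
Variables (A : set (chart R M m)) (B : set (chart R N n)).
Variables (C : set (chart R P p)).
Hypotheses (hA : smooth_atlas A) (hB : smooth_atlas B) (hC : smooth_atlas C).

Lemma smooth_map_comp (f : M -> N) (g : N -> P) :
  smooth_map A B f -> smooth_map B C g -> smooth_map A C (g \o f).
Proof.
move=> sf sg; apply: smooth_map_local => // x.
have [_ /(_ x)[c Ac cx] _] := hA.
have [_ /(_ (f x))[d Bd dx] _] := hB.
have [_ /(_ (g (f x)))[e Ce ex] _] := hC.
have [oO1 [F FE sF]] := sf _ _ Ac Bd.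
have [oO2 [G GE sG]] := sg _ _ Bd Ce.
have oV := smooth_on_preimage_open oO1 oO2 sF.
exists c, e, (overlap f c d `&` F @^-1` overlap g d e), (G \o F).
split => //.
- split=> //; split; first by exists x.
  by rewrite /= (FE _ cx dx); exists (f x).
- by split=> // y [[z [cz _] <-] _]; exists z.
- move=> y cy [Oy]; have dfy := overlapP hA Ac cy Oy.
  rewrite /= (FE _ cy dfy) => O2y.
  have egfy := overlapP hB Bd dfy O2y.
  by split=> //; rewrite (GE _ dfy egfy).
- apply: (smooth_on_comp oV oO2) => // [y []//|].
  by apply: smooth_on_sub sF => y [].
Qed.

End SmoothComp.

End Charts.

Section LocalSections.
Context {R : realType}.

Lemma CkN_mulmxr m n k (U : set 'rV[R]_m) (L : 'M[R]_(m, n)) :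
  CkN k U (fun x : 'rV[R]_m => x *m L).
Proof.
by apply: (@CkN_linear _ _ _ _ _ (mulmxr L)); exact: rV_linear_continuous.
Qed.

Lemma is_diff_mulmxr m n (L : 'M[R]_(m, n)) (x : 'rV[R]_m) :
  is_diff x (fun x : 'rV[R]_m => x *m L) (mulmxr L).
Proof.
pose l : {linear 'rV[R]_m -> 'rV[R]_n} := mulmxr L.
suff : is_diff x l l by [].
have c : continuous l by exact: rV_linear_continuous.
by apply: DiffDef; [exact: linear_differentiable|exact: diff_lin].
Qed.

(** With L a right inverse of 'd f x0, the map z |-> f (x0 + z L) has the
    identity as differential at 0; its local inverse followed by
    z |-> x0 + z L is the section. *)
Lemma local_section m n (U : set 'rV[R]_m) (f : 'rV[R]_m -> 'rV[R]_n) x0 :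
  open U -> U x0 -> smooth_on U f -> set_surj setT setT ('d f x0) ->
  exists W s, [/\ open W /\ W (f x0), s (f x0) = x0,
    forall y, W y -> U (s y) /\ f (s y) = y & smooth_on W s].
Proof.
move=> oU Ux0 /smooth_onE sf surj.
have /choice[v vE] (j : 'I_n) : exists v, 'd f x0 v = delta_mx 0 j.
  by have [v _ vE] := surj (delta_mx 0 j) I; exists v.
pose L := \matrix_j v j.
have LJ : L *m jacobian f x0 = 1%:M.
  apply/row_matrixP => j; rewrite row_mul rowK row1 -diff_jacobian.
  exact: vE.
pose l (z : 'rV[R]_n) := z *m L + x0.
have cl k (B : set 'rV[R]_n) : open B -> CkN k B l.
  by move=> oB; apply: CkN_add => //; [exact: CkN_mulmxr|exact: CkN_cst].
pose U' := [set: 'rV[R]_n] `&` l @^-1` U.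
have oU' : open U'.
  apply: smooth_on_preimage_open; [exact: openT|exact: oU|].
  by apply/smooth_onE => k; apply: cl; exact: openT.
have l0 : l 0 = x0 by rewrite /l mul0mx add0r.
have U'0 : U' 0 by split=> //=; rewrite l0.
have cg k : CkN k U' (f \o l).
  by apply: (CkN_comp oU' oU) => // [z []//|]; exact: cl.
have g0 w : 'd (f \o l) 0 w = w.
  have dl := is_diffD (is_diff_mulmxr L 0) (is_diff_cst x0 0).
  have df : is_diff (l 0) f ('d f x0).
    by rewrite l0; apply: differentiableP; exact: (sf 1%N).1.
  have D := is_diff_comp dl df.
  apply: eq_trans (is_diffE w D) _.
  rewrite /= diff_jacobian fctE /= addr0.
  by rewrite -mulmxA LJ mulmx1.
have [V [h [[oV V0] VU oVg hK sh]]] := local_inverse oU' U'0 cg g0.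
exists ((f \o l) @` V), (l \o h).
have fE : (f \o l) 0 = f x0 by rewrite /= l0.
split.
- by split=> //; exists 0.
- by rewrite -fE /= hK.
- by move=> _ [z Vz <-]; rewrite /= (hK z Vz); split => //; exact: (VU z Vz).2.
- apply: (smooth_on_comp oVg openT) => //.
  by apply/smooth_onE => k; apply: cl; exact: openT.
Qed.

(** With L a left inverse of 'd f x0, the map x |-> (f x) L has the identity
    as differential at x0, and its local inverse undoes it. *)
Lemma local_left_inverse m n (U : set 'rV[R]_m) (f : 'rV[R]_m -> 'rV[R]_n) x0 :
  open U -> U x0 -> smooth_on U f -> injective ('d f x0) ->
  exists V A k, [/\ open V /\ V x0, V `<=` U, open A,
    forall x, V x -> A (f x) /\ k (f x) = x & smooth_on A k].
Proof.
move=> oU Ux0 /smooth_onE sf inj.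
have /row_freeP[L JL] : row_free (jacobian f x0).
  apply: inj_row_free => v; rewrite -diff_jacobian => v0.
  by apply: inj; rewrite v0 linear0.
pose l (z : 'rV[R]_n) := z *m L.
have cg k : CkN k U (l \o f).
  by apply: (CkN_comp oU openT) => //; exact: CkN_mulmxr.
have g0 w : 'd (l \o f) x0 w = w.
  have D := is_diff_comp (differentiableP ((sf 1%N).1 x0 Ux0))
    (is_diff_mulmxr L (f x0)).
  apply: eq_trans (is_diffE w D) _.
  by rewrite /= diff_jacobian -mulmxA JL mulmx1.
have [V [h [[oV V0] VU oVg hK sh]]] := local_inverse oU Ux0 cg g0.
have sl : smooth_on setT l by apply/smooth_onE => k; exact: CkN_mulmxr.
pose A := setT `&` l @^-1` ((l \o f) @` V).
have oA : open A by apply: (smooth_on_preimage_open openT).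
exists V, A, (h \o l); split => //.
- by move=> x Vx; split; [split => //; exists x|exact: hK].
- apply: (smooth_on_comp oA oVg) => // [x []//|].
  by apply: smooth_on_sub sl.
Qed.

End LocalSections.

Section Descent.
Context {R : realType}.

(** Near any point, g is (g o f) o s for a local section s of f. *)
Lemma submersion_descent (M N P : Type) m n p (A : set (chart R M m))
    (B : set (chart R N n)) (C : set (chart R P p)) (f : M -> N) (g : N -> P) :
  smooth_atlas A -> smooth_atlas B -> smooth_atlas C ->
  submersion A B f -> (forall y, exists x, f x = y) ->
  smooth_map A C (g \o f) -> smooth_map B C g.
Proof.
move=> hA hB hC [sf subm] surj sgf.
apply: smooth_map_local => // y; have [x fx] := surj y.
have [_ /(_ x)[c Ac cx] _] := hA.
have [_ /(_ y)[d Bd dy] _] := hB.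
have [_ /(_ (g y))[e Ce ey] _] := hC.
rewrite -{}fx in dy ey *.
have [oO1 [F FE sF]] := sf _ _ Ac Bd.
have [oO2 [G GE sG]] := sgf _ _ Ac Ce.
have O1x : overlap f c d (cmap c x) by exists x.
have [W [s [[oW Wx] sx sP ss]]] :=
  local_section oO1 O1x sF (subm _ _ _ _ Ac Bd FE cx dy).
rewrite (FE _ cx dy) in Wx sx.
have oV := smooth_on_preimage_open oW oO2 ss.
exists d, e, (W `&` s @^-1` overlap (g \o f) c e), (G \o s); split => //.
- by split=> //; split=> //=; rewrite sx; exists x.
- split=> // z [Wz _]; have [[w [cw dw] E] Fs] := sP z Wz.
  by exists (f w) => //; rewrite -(FE _ cw dw) E.
- move=> z dz [Wz [w [cw ew] Es]].
  have [Us Fs] := sP _ Wz; rewrite -Es in Us Fs.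
  have dw : cdom d (f w) by exact: (overlapP hA Ac cw Us).
  rewrite (FE _ cw dw) in Fs.
  have wz : f w = z by exact: (cmap_inj hB Bd dw dz Fs).
  by rewrite /= -Es (GE _ cw ew) /= wz -{1}wz.
- apply: (smooth_on_comp oV oO2) => // [z []//|].
  by apply: smooth_on_sub ss => z [].
Qed.

(** In a chart of M, f is k o (i o f) with k a local left inverse of i. This
    holds only where f stays in the domain of that chart and close to f x;
    as the topology of M is induced by i, the continuity of i o f ensures it. *)
Lemma embedding_lift (M P : Type) m p N (A : set (chart R M m))
    (C : set (chart R P p)) (i : M -> 'rV[R]_N) (f : P -> M) :
  smooth_atlas A -> smooth_atlas C ->
  smooth_embedding A (@euclidean_atlas R N) i ->
  smooth_map C (@euclidean_atlas R N) (i \o f) -> smooth_map C A f.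
Proof.
move=> hA hC [[si imm] _ emb] sif.
apply: smooth_map_local => // x.
have [_ /(_ x)[c Cc cx] _] := hC.
have [_ /(_ (f x))[d Ad dx] tA] := hA.
pose E : chart R 'rV[R]_N N := Chart setT id.
have EE : @euclidean_atlas R N E by [].
have [oO1 [F FE sF]] := sif _ _ Cc EE.
have [oO2 [G GE sG]] := si _ _ Ad EE.
have O2x : overlap i d E (cmap d (f x)) by exists (f x).
have [V [B [k [[oV Vx] VO oB kP sk]]]] :=
  local_left_inverse oO2 O2x sG (imm _ _ _ _ Ad EE GE dx I).
pose W0 := cdom d `&` cmap d @^-1` V.
have W0_open : atlas_open A W0.
  move=> c' Ac'; have [oO [t tE st]] := tA _ _ Ac' Ad.
  have -> : cmap c' @` (cdom c' `&` W0) = overlap id c' d `&` t @^-1` V.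
    apply/seteqP; split=> [_ [y [c'y [dy Vy]] <-]|_ [[y [c'y dy] <-] Vy]].
      by split; [exists y|rewrite /= (tE _ c'y dy)].
    by exists y => //; split => //; split => //=; rewrite -(tE _ c'y dy).
  exact: smooth_on_preimage_open.
(* near x, i o f stays in V', hence f stays in W0, where k inverts i *)
have [V' V'_open W0E] := emb _ W0_open.
have oV' : open V'.
  have := V'_open _ EE.
  by rewrite (_ : _ @` _ = V')//= setTI image_id.
have iV y : V' (i y) <-> W0 y by rewrite W0E.
have oVB : open (V' `&` B) by exact: openI.
have oW := smooth_on_preimage_open oO1 oVB sF.
exists c, d, (overlap (i \o f) c E `&` F @^-1` (V' `&` B)), (k \o F).
have fE y : cdom c y -> F (cmap c y) = i (f y) by move=> cy; exact: FE.
have gE y : cdom d y -> G (cmap d y) = i y by move=> dy; exact: GE.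
split => //.
- split=> //; split; first by exists x.
  rewrite /= (fE _ cx); split; first by apply/iV; split.
  by rewrite -(gE _ dx); exact: (kP _ Vx).1.
- by split=> // _ [[y [cy _] <-] _]; exists y.
- move=> y cy [_ /=]; rewrite (fE _ cy) => -[/iV[dy Vy] By].
  by split=> //; rewrite -(gE _ dy); exact: (kP _ Vy).2.
- apply: (smooth_on_comp oW oB) => // [y [_ []]//|].
  by apply: smooth_on_sub sF => y [].
Qed.

End Descent.

(** * Quaternions and uniqueness of power series *)

Section QuatAlgebra.
Context {R : realType}.
Implicit Types p q u w : quat R.

Lemma quatME p q :
  (qr (p * q) = qr p * qr q - qi p * qi q - qj p * qj q - qk p * qk q) *
  (qi (p * q) = qr p * qi q + qi p * qr q + qj p * qk q - qk p * qj q) *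
  (qj (p * q) = qr p * qj q - qi p * qk q + qj p * qr q + qk p * qi q) *
  (qk (p * q) = qr p * qk q + qi p * qj q - qj p * qi q + qk p * qr q).
Proof. by rewrite !mkquatE. Qed.

Lemma quat1E :
  (qr (1 : quat R) = 1) * (qi (1 : quat R) = 0) *
  (qj (1 : quat R) = 0) * (qk (1 : quat R) = 0).
Proof. by rewrite !mkquatE. Qed.

Lemma quatNE q :
  (qr (- q) = - qr q) * (qi (- q) = - qi q) *
  (qj (- q) = - qj q) * (qk (- q) = - qk q).
Proof. by rewrite /qr /qi /qj /qk !mxE. Qed.

Lemma qconjE q :
  (qr (qconj q) = qr q) * (qi (qconj q) = - qi q) *
  (qj (qconj q) = - qj q) * (qk (qconj q) = - qk q).
Proof. by rewrite !mkquatE. Qed.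

Definition quatE := (quatDE, quatNE, quatZE, quatME, quat1E, quat0E, qconjE).

Ltac quat_ring := apply: quatP; rewrite !quatE; ring.

Lemma qscaleAl (x : R) p q : x *: (p * q) = (x *: p) * q.
Proof. by quat_ring. Qed.

Lemma qscaleAr (x : R) p q : x *: (p * q) = p * (x *: q).
Proof. by quat_ring. Qed.

Lemma qconjM p q : qconj (p * q) = qconj q * qconj p.
Proof. by quat_ring. Qed.

Lemma qconjD p q : qconj (p + q) = qconj p + qconj q.
Proof. by quat_ring. Qed.

Lemma qconjN q : qconj (- q) = - qconj q.
Proof. by quat_ring. Qed.

Lemma qconjZ (x : R) q : qconj (x *: q) = x *: qconj q.
Proof. by quat_ring. Qed.

Lemma qconjK q : qconj (qconj q) = q.
Proof. by quat_ring. Qed.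

Lemma qconj1 : qconj (1 : quat R) = 1.
Proof. by quat_ring. Qed.

Lemma qconj0 : qconj (0 : quat R) = 0.
Proof. by quat_ring. Qed.

Lemma qmul_conj q : q * qconj q = qsqn q *: (1 : quat R).
Proof. by apply: quatP; rewrite !quatE /qsqn; ring. Qed.

Lemma qconj_mul q : qconj q * q = qsqn q *: (1 : quat R).
Proof. by apply: quatP; rewrite !quatE /qsqn; ring. Qed.

Lemma qadd_conj q : q + qconj q = (2 * qr q) *: (1 : quat R).
Proof. by quat_ring. Qed.

Lemma qsqnM p q : qsqn (p * q) = qsqn p * qsqn q.
Proof. by rewrite /qsqn !quatE; ring. Qed.

Lemma qsqn_conj q : qsqn (qconj q) = qsqn q.
Proof. by rewrite /qsqn !quatE; ring. Qed.

Lemma qsqnN q : qsqn (- q) = qsqn q.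
Proof. by rewrite /qsqn !quatE; ring. Qed.

Lemma qsqnZ (x : R) q : qsqn (x *: q) = x ^+ 2 * qsqn q.
Proof. by rewrite /qsqn !quatE; ring. Qed.

Lemma qsqn1 : qsqn (1 : quat R) = 1.
Proof. by rewrite /qsqn !quatE; ring. Qed.

Lemma qsqn0 : qsqn (0 : quat R) = 0.
Proof. by rewrite /qsqn !quatE; ring. Qed.

Lemma qsqn_ge0 q : 0 <= qsqn q.
Proof. by rewrite /qsqn !addr_ge0 ?sqr_ge0. Qed.

Lemma quat_unitE q : (q \is a GRing.unit) = (q != 0).
Proof. by []. Qed.

Lemma qsqnV q : qsqn q^-1 = (qsqn q)^-1.
Proof.
have [->|q0] := eqVneq q 0.
  by rewrite invr0 qsqn0 invr0.
have qn0 : qsqn q != 0 by rewrite qsqn_eq0.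
by apply: (mulIf qn0); rewrite mulVf// -qsqnM mulVr ?qsqn1// quat_unitE.
Qed.

Lemma qabsM p q : qabs (p * q) = qabs p * qabs q.
Proof. by rewrite /qabs qsqnM sqrtrM// qsqn_ge0. Qed.

Lemma qabsX q n : qabs (q ^+ n) = qabs q ^+ n.
Proof.
elim: n => [|n IH]; first by rewrite !expr0 /qabs qsqn1 sqrtr1.
by rewrite !exprS qabsM IH.
Qed.

Lemma qabs_conj q : qabs (qconj q) = qabs q.
Proof. by rewrite /qabs qsqn_conj. Qed.

Lemma qabs_ge0 q : 0 <= qabs q.
Proof. exact: sqrtr_ge0. Qed.

Lemma qabs_lt1 q : (qabs q < 1) = (qsqn q < 1).
Proof. by rewrite /qabs -{1}(@sqrtr1 R) ltr_sqrt. Qed.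

Lemma qabs_eq1 q : (qabs q = 1) <-> (qsqn q = 1).
Proof.
split=> [|h]; last by rewrite /qabs h sqrtr1.
by rewrite -(sqr_sqrtr (qsqn_ge0 q)) -/(qabs q) => ->; rewrite expr1n.
Qed.

(** The norm of [quat] is the sup norm of the coordinates, whereas [qabs] is
    the multiplicative one; this comparison turns estimates for [qabs] into
    convergence. *)
Lemma norm_le_qabs q : `|q| <= qabs q.
Proof.
apply: norm_le_coord; first exact: qabs_ge0.
move=> i j; rewrite (ord1 i) -sqrtr_sqr ler_wsqrtr//.
have := (sqr_ge0 (qr q), sqr_ge0 (qi q), sqr_ge0 (qj q), sqr_ge0 (qk q)).
case=> [[[]]]; rewrite /qsqn /qr /qi /qj /qk => h0 h1 h2 h3.
case: j => -[|[|[|[|//]]]] hj.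
- by rewrite (_ : Ordinal hj = 0); [lra|exact/val_inj].
- by rewrite (_ : Ordinal hj = 1); [lra|exact/val_inj].
- by rewrite (_ : Ordinal hj = 2%:R); [lra|exact/val_inj].
- by rewrite (_ : Ordinal hj = 3%:R); [lra|exact/val_inj].
Qed.

Lemma unit_ballE q : unit_ball R q <-> qsqn q < 1.
Proof. by rewrite /unit_ball /= qabs_lt1. Qed.

Lemma qmulr_linear p : linear (fun q => q * p).
Proof. by move=> x u v; rewrite mulrDl qscaleAl. Qed.

Lemma qmull_linear p : linear (fun q => p * q).
Proof. by move=> x u v; rewrite mulrDr qscaleAr. Qed.

Lemma qmulr_continuous p : continuous (fun q : quat R => q * p).
Proof.
pose lM := GRing.isLinear.Build _ _ _ _ _ (qmulr_linear p).
pose L : {linear 'rV[R]_4 -> quat R} := HB.pack (fun q : quat R => q * p) lM.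
exact: (@rV_linear_continuous _ _ _ L).
Qed.

Lemma qmull_continuous p : continuous (fun q : quat R => p * q).
Proof.
pose lM := GRing.isLinear.Build _ _ _ _ _ (qmull_linear p).
pose L : {linear 'rV[R]_4 -> quat R} := HB.pack (fun q : quat R => p * q) lM.
exact: (@rV_linear_continuous _ _ _ L).
Qed.

Lemma cvg_qmulr (u : nat -> quat R) (l : quat R) p :
  u @ \oo --> l -> (fun n => u n * p) @ \oo --> l * p.
Proof. by move=> ul; exact: (cvg_comp _ _ ul (@qmulr_continuous p l)). Qed.

Lemma cvg_qmull (u : nat -> quat R) (l : quat R) p :
  u @ \oo --> l -> (fun n => p * u n) @ \oo --> p * l.
Proof. by move=> ul; exact: (cvg_comp _ _ ul (@qmull_continuous p l)). Qed.

End QuatAlgebra.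

Section PowerSeries.
Context {R : realType}.

Lemma geometric_tail (y : R) N : 0 <= y -> y <= 2^-1 ->
  \sum_(n < N) y ^+ n.+1 <= 2 * y.
Proof.
move=> y0 y1; suff H : \sum_(n < N) y ^+ n.+1 <= 2 * y - 2 * y ^+ N.+1.
  by apply: le_trans H _; rewrite lerBlDr lerDl mulr_ge0// exprn_ge0.
elim: N => [|N IH]; first by rewrite big_ord0 expr1 subrr.
rewrite big_ord_recr /=; have := IH.
have : 0 <= y ^+ N.+1 * (1 - 2 * y).
  by rewrite mulr_ge0 ?exprn_ge0// subr_ge0 -ler_pdivlMl// mulr1.
by rewrite [y ^+ N.+2]exprS; lra.
Qed.

(** Convergence at 1/2 bounds c_n by K 2^n, so for x <= 1/4 the series minus
    its first term is at most 4 K x, which tends to 0 with x. *)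
Lemma pseries_coef0 (V : normedModType R) (c : nat -> V) :
  (forall x : R, 0 < x -> x < 1 ->
     series (fun n => x ^+ n *: c n) @ \oo --> 0) ->
  c 0%N = 0.
Proof.
move=> H.
have h0 : 0 < 2^-1 :> R by rewrite invr_gt0.
have h1 : 2^-1 < 1 :> R by rewrite invf_lt1 ?ltr1n.
have [K K0 HK] : exists2 K : R, 0 < K & forall n, `|c n| <= K * 2 ^+ n.
  have /cvgP/cvg_series_cvg_0/cvgP/cvg_seq_bounded := H _ h0 h1.
  move=> /ex_strict_bound_gt0[K K0 HK]; exists K => // n.
  have /ltW := HK n I; rewrite normrZ normrX gtr0_norm//.
  by rewrite exprVn ler_pdivrMl ?exprn_gt0// mulrC.
have bd (x : R) : 0 < x -> x <= 4^-1 -> `|c 0%N| <= 4 * K * x.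
  move=> x0 x4; have x1 : x < 1 by lra.
  apply/ler_addgt0Pr => e e0.
  have /cvgrPdist_le/(_ _ e0) := H x x0 x1.
  case=> N _ /(_ N.+1 (leqnSn _)); rewrite /= sub0r normrN seriesEnat /= => He.
  move: He; rewrite big_nat_recl// expr0 scale1r big_mkord => He.
  have -> : c 0%N = (c 0%N + \sum_(i < N) x ^+ i.+1 *: c i.+1)
      - \sum_(i < N) x ^+ i.+1 *: c i.+1 by rewrite addrK.
  apply: le_trans (ler_normB _ _) _; rewrite addrC; apply: lerD => //.
  apply: le_trans (ler_norm_sum _ _ _) _.
  apply: (@le_trans _ _ (\sum_(i < N) K * (2 * x) ^+ i.+1)).
    apply: ler_sum => i _; rewrite normrZ normrX gtr0_norm//.
    by rewrite exprMn mulrA mulrC ler_wpM2r ?exprn_ge0 ?(ltW x0).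
  rewrite -mulr_sumr [4 * K]mulrC -mulrA ler_wpM2l ?(ltW K0)//.
  apply: le_trans (geometric_tail _ _ _) _; lra.
apply/eqP; rewrite -normr_le0; apply/ler_addgt0Pr => e e0; rewrite add0r.
pose x := Num.min 4^-1 (e / (4 * K)).
have x0 : 0 < x by rewrite lt_min invr_gt0 ltr0n/= divr_gt0// mulr_gt0.
apply: le_trans (bd x x0 _) _; first by rewrite ge_min lexx.
by rewrite mulrC -ler_pdivlMr ?mulr_gt0// ge_min lexx orbT.
Qed.

Lemma pseries_coef_eq0 (V : normedModType R) (c : nat -> V) :
  (forall x : R, 0 < x -> x < 1 ->
     series (fun n => x ^+ n *: c n) @ \oo --> 0) ->
  forall n, c n = 0.
Proof.
move=> H n; elim: n c H => [|n IH] c H; first exact: pseries_coef0.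
apply: (IH (fun n => c n.+1)) => x x0 x1.
have c0 := pseries_coef0 H.
have -> : series (fun n => x ^+ n *: c n.+1) =
    (fun N => x^-1 *: series (fun n => x ^+ n *: c n) N.+1).
  apply/funext => N; rewrite !seriesEnat /= big_nat_recl// c0 scaler0 add0r.
  rewrite scaler_sumr; apply: eq_bigr => i _.
  by rewrite scalerA exprS mulKf ?gt_eqF.
rewrite -[X in _ --> X](scaler0 _ x^-1).
apply: cvgZ; first exact: cvg_cst.
by rewrite (cvg_shiftS (series _)); exact: H.
Qed.

(** The real points of the ball are enough to determine the coefficients: the
    variable is then central and the series is an ordinary power series. *)
Lemma qpseries_unique (a b : nat -> quat R) (f : quat R -> quat R) :
  (forall q, unit_ball R q -> qpseries a q @ \oo --> f q) ->
  (forall q, unit_ball R q -> qpseries b q @ \oo --> f q) -> a = b.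
Proof.
move=> Ha Hb; apply/funext => n.
apply/eqP; rewrite -subr_eq0; apply/eqP; move: n.
apply: (@pseries_coef_eq0 (quat R) (fun n => a n - b n)) => x x0 x1.
have Bx : unit_ball R (x *: (1 : quat R)).
  by apply/unit_ballE; rewrite qsqnZ qsqn1 mulr1 expr_lt1// ltW.
have xX n : (x *: (1 : quat R)) ^+ n = x ^+ n *: (1 : quat R).
  elim: n => [|n IH]; first by rewrite !expr0 scale1r.
  by rewrite exprS IH -qscaleAl mul1r scalerA -exprS.
have -> : series (fun n => x ^+ n *: (a n - b n)) =
    (qpseries a (x *: (1 : quat R)) - qpseries b (x *: (1 : quat R)))%R.
  apply/funext => N.
  rewrite /qpseries fctE !seriesEnat /= -sumrB; apply: eq_bigr => i _.
  by rewrite xX -!qscaleAl !mul1r scalerBr.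
have := cvgB (Ha _ Bx) (Hb _ Bx); rewrite subrr; exact.
Qed.

(** Expansions being unique, exhibiting one computes [coefs]. *)
Lemma coefs_eq (a : nat -> quat R) (f : quat R -> quat R) :
  (forall q, unit_ball R q -> qpseries a q @ \oo --> f q) -> coefs f = a.
Proof.
move=> Ha; apply: (@qpseries_unique _ _ f) => //.
by apply: (@xgetPex _ (fun=> 0) [set a | forall q, unit_ball R q ->
  qpseries a q @ \oo --> f q]); exists a.
Qed.

Lemma qpsum_eq (a : nat -> quat R) (q l : quat R) :
  qpseries a q @ \oo --> l -> qpsum a q = l.
Proof. by move=> H; apply: cvg_lim => //; exact: norm_hausdorff. Qed.

End PowerSeries.

(** * Power series of the regular Moebius transformations *)

Section LinearCoefs.
Context {R : realType}.
Implicit Types a b c d p q : quat R.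

Lemma qpseries_finite (a : nat -> quat R) m q :
  (forall n, (m <= n)%N -> a n = 0) ->
  qpseries a q @ \oo --> \sum_(n < m) q ^+ n * a n.
Proof.
move=> a0; apply: cvg_near_cst; exists m => // N /= mN.
rewrite /qpseries seriesEnat /= (big_cat_nat (leq0n m) mN)//= big_mkord.
rewrite [X in _ + X]big_nat_cond [X in _ + X]big1 ?addr0//.
move=> i /andP[/andP[mi _] _].
by rewrite a0// mulr0.
Qed.

Definition lin_coefs a b : nat -> quat R := nth 0 [:: b; a].

Lemma qpseries_lin a b q : qpseries (lin_coefs a b) q @ \oo --> lin a b q.
Proof.
have -> : lin a b q = \sum_(n < 2) q ^+ n * lin_coefs a b n.
  by rewrite !big_ord_recl big_ord0 /= expr0 expr1 mul1r addr0 addrC.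
by apply: qpseries_finite => -[|[|n]] // _; rewrite /lin_coefs /= nth_nil.
Qed.

Lemma coefs_lin a b : coefs (lin a b) = lin_coefs a b.
Proof. by apply: coefs_eq => q _; exact: qpseries_lin. Qed.

Lemma regconj_lin a b : regconj (lin a b) = lin (qconj a) (qconj b).
Proof.
apply/funext => q; apply: qpsum_eq; rewrite coefs_lin.
have -> : (fun n => qconj (lin_coefs a b n)) = lin_coefs (qconj a) (qconj b).
  by apply/funext => -[|[|n]] //; rewrite /lin_coefs /= nth_nil qconj0.
exact: qpseries_lin.
Qed.

(** Only the coefficients of degree at most 2 survive. *)
Lemma symmetrization_lin a b q : symmetrization (lin a b) q =
  b * qconj b + q * (b * qconj a + a * qconj b) + q ^+ 2 * (a * qconj a).
Proof.
apply: qpsum_eq; rewrite regconj_lin !coefs_lin.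
set u := fun n => _.
have -> : b * qconj b + q * (b * qconj a + a * qconj b) + q ^+ 2 * (a * qconj a)
    = \sum_(n < 3) q ^+ n * u n.
  rewrite !big_ord_recl !big_ord0 /= /u !big_ord_recl !big_ord0 /= /lin_coefs /=.
  by rewrite expr0 expr1 mul1r !addr0 mul0r mulr0 add0r addr0 addrA.
apply: qpseries_finite => -[|[|[|n]]] // _; rewrite /u.
rewrite big_ord_recl big_ord_recl big1 => [|i _]; rewrite /lin_coefs /= ?nth_nil.
  by rewrite !mulr0 !addr0.
by rewrite mul0r.
Qed.

End LinearCoefs.

Section Kernel.
Context {R : realType}.
Implicit Types a b c d p q : quat R.

(** The series sum_n q^n p^n is the regular reciprocal of 1 - q p. Shifting it
    gives S = 1 + q S p, an equation that characterizes S ([kernel_unique])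
    and replaces a closed form. *)
Lemma cvg_kernel q p : qabs q < 1 -> qabs p < 1 ->
  exists S : quat R, series (fun n => q ^+ n * p ^+ n) @ \oo --> S /\
    S = 1 + q * S * p.
Proof.
move=> q1 p1; pose u n := q ^+ n * p ^+ n.
have cu : cvgn (series u).
  apply: (@normed_cvg R 'rV[R]_4 u).
  apply: (@series_le_cvg _ _ (geometric 1 (qabs q * qabs p))).
  - by move=> n; exact: normr_ge0.
  - by move=> n; rewrite /= mul1r exprn_ge0// mulr_ge0// qabs_ge0.
  - move=> n; apply: le_trans (norm_le_qabs _) _.
    by rewrite /u qabsM !qabsX -exprMn /= mul1r.
  - apply: is_cvg_geometric_series; rewrite ger0_norm ?mulr_ge0 ?qabs_ge0//.
    by rewrite mulr_ilt1 ?qabs_ge0.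
exists (limn (series u)); split; first exact: cu.
have uS : (fun n => series u n.+1) = (fun n => 1 + q * series u n * p).
  apply/funext => n; rewrite !seriesEnat /= big_nat_recl//.
  rewrite {1}/u !expr0 mulr1; congr (_ + _).
  rewrite mulr_sumr mulr_suml; apply: eq_bigr => i _.
  by rewrite /u exprS exprSr !mulrA.
have c1 : series u n.+1 @[n --> \oo] --> limn (series u) by rewrite cvg_shiftS.
have c2 : 1 + q * series u n * p @[n --> \oo] --> 1 + q * limn (series u) * p.
  by apply: cvgD; [exact: cvg_cst|exact/cvg_qmulr/cvg_qmull].
rewrite uS in c1.
exact: (cvg_unique _ c1 c2).
Qed.

(** The symmetrization of 1 - q p has the real coefficients 1, - 2 Re p and
    |p|^2. Since they are central, the equation of S can be used twice, once
    for p and once for its conjugate. *)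
Lemma kernel_quadratic q p S : S = 1 + q * S * p ->
  S - (2 * qr p) *: (q * S) + qsqn p *: (q ^+ 2 * S) = 1 - q * qconj p.
Proof.
move=> SE.
(* 2 Re p = p + conj p *)
have E1 : (2 * qr p) *: (q * S) = q * S * p + q * S * qconj p.
  by rewrite -mulrDr qadd_conj -qscaleAr mulr1.
have E2 : q * S * qconj p = q * qconj p + qsqn p *: (q ^+ 2 * S).
  rewrite {1}SE mulrDr mulr1 mulrDl; congr (_ + _).
  by rewrite expr2 -!mulrA qmul_conj -!qscaleAr mulr1.
rewrite E1 E2 {1}SE.
by rewrite opprD opprD !addrA addrK subrK.
Qed.

(** As q c + d = d - q (d p), its symmetrization is |d|^2 times the quadratic
    expression of [kernel_quadratic]; it does not vanish on the ball, because
    its product with S d^-1 is (1 - q (conj p)) (conj d). *)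
Lemma star_recip_lin c d q p S : d != 0 -> c = - (d * p) -> S = 1 + q * S * p ->
  qabs q < 1 -> qabs p < 1 -> star_recip (lin c d) q = S * d^-1.
Proof.
move=> d0 cE SE q1 p1.
have dU : d \is a GRing.unit by rewrite quat_unitE.
rewrite /star_recip regconj_lin symmetrization_lin.
set D := _ + _ + _.
have DS : D * (S * d^-1) = lin (qconj c) (qconj d) q.
  have DE : D = qsqn d *: (1 - (2 * qr p) *: q + qsqn p *: q ^+ 2).
    have t : d * qconj c + c * qconj d =
        - ((qsqn d * (2 * qr p)) *: (1 : quat R)).
      rewrite cE qconjN qconjM mulrN mulNr -opprD !mulrA -mulrDl -mulrDr addrC.
      rewrite qadd_conj -qscaleAr mulr1 -qscaleAl qmul_conj scalerA.
      by congr (- (_ *: _)); ring.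
    rewrite /D t !qmul_conj cE qsqnN qsqnM mulrN -!qscaleAr !mulr1.
    by rewrite scalerDr scalerBr !scalerA.
  have E : (1 - (2 * qr p) *: q + qsqn p *: q ^+ 2) * S = 1 - q * qconj p.
    by rewrite -(kernel_quadratic SE) mulrDl mulrBl mul1r -!qscaleAl.
  rewrite DE -qscaleAl mulrA E /lin cE qconjN qconjM.
  have -> : d^-1 = (qsqn d)^-1 *: qconj d by [].
  rewrite -!qscaleAr scalerA mulfV ?qsqn_eq0// scale1r.
  by rewrite mulrBl mul1r addrC mulrN mulrA.
have lin0 : lin (qconj c) (qconj d) q != 0.
  apply/eqP => /(congr1 (@qsqn R)).
  rewrite /lin cE qconjN qconjM mulrN mulrA -{2}[qconj d]mul1r addrC -mulrBl.
  rewrite qsqnM qsqn_conj qsqn0 => /eqP.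
  rewrite mulf_eq0 !qsqn_eq0 (negPf d0) orbF subr_eq0.
  move=> /eqP/(congr1 (@qsqn R)).
  rewrite qsqn1 qsqnM qsqn_conj => E; rewrite !qabs_lt1 in q1 p1.
  by have := mulr_ilt1 (qsqn_ge0 q) (qsqn_ge0 p) q1 p1; rewrite -E ltxx.
have D0 : D != 0 by apply: contra_neq lin0 => D0; rewrite -DS D0 mul0r.
by rewrite -DS mulKr ?quat_unitE.
Qed.

Lemma cvg_kernel_mulr q p (S : quat R) d :
  series (fun n => q ^+ n * p ^+ n) @ \oo --> S ->
  qpseries (fun n => p ^+ n * d) q @ \oo --> S * d.
Proof.
move=> cS.
have -> : qpseries (fun n => p ^+ n * d) q =
    (fun N => series (fun n => q ^+ n * p ^+ n) N * d).
  apply/funext => N; rewrite /qpseries !seriesEnat /= mulr_suml.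
  by apply: eq_bigr => i _; rewrite mulrA.
exact: cvg_qmulr.
Qed.

Lemma coefs_star_recip_lin c d p : d != 0 -> c = - (d * p) -> qabs p < 1 ->
  coefs (star_recip (lin c d)) = (fun n => p ^+ n * d^-1).
Proof.
move=> d0 cE p1; apply: coefs_eq => q q1.
have [S [cS SE]] := cvg_kernel q1 p1.
rewrite (star_recip_lin d0 cE SE q1 p1); exact: cvg_kernel_mulr.
Qed.

(** A polynomial of degree 1 on the right mixes only two consecutive
    coefficients of the left factor, and the sum can be split back. *)
Lemma star_lin_coefs (r : nat -> quat R) a b q (X : quat R) :
  qpseries r q @ \oo --> X ->
  qpsum (fun n => \sum_(k < n.+1) r k * lin_coefs a b (n - k)%N) q =
    X * b + q * X * a.
Proof.
move=> rX; apply: qpsum_eq.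
set u := fun n => _.
have u0 : u 0%N = r 0%N * b by rewrite /u big_ord_recl big_ord0 addr0.
have uS n : u n.+1 = r n * a + r n.+1 * b.
  rewrite /u big_ord_recr big_ord_recr /= subnn subSnn big1 ?add0r// => i _.
  rewrite (_ : (n.+1 - i)%N = (n - i).-1.+2).
    by rewrite /lin_coefs /= nth_nil mulr0.
  by rewrite prednK ?subn_gt0// subSn// ltnW.
have uE : (fun N => qpseries u q N.+1) =
    (fun N => qpseries r q N.+1 * b + q * qpseries r q N * a).
  apply/funext => N; elim: N => [|N IH].
    rewrite /qpseries !seriesEnat /= !big_nat1 big_geq//.
    by rewrite mulr0 mul0r addr0 u0 mulrA.
  have sS (v : nat -> quat R) n :
      qpseries v q n.+1 = qpseries v q n + q ^+ n * v n.
    by rewrite /qpseries !seriesEnat /= big_nat_recr.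
  have e : q * qpseries r q N.+1 * a =
      q * qpseries r q N * a + q ^+ N.+1 * r N * a.
    by rewrite sS mulrDr mulrDl exprS !mulrA.
  rewrite sS IH uS (sS r N.+1) e mulrDr mulrDl !mulrA.
  by rewrite [X in _ + X]addrC addrACA.
rewrite -(cvg_shiftS (qpseries u q)) uE; apply: cvgD.
  by apply: cvg_qmulr; rewrite cvg_shiftS.
by apply: cvg_qmulr; exact: cvg_qmull.
Qed.

Lemma moebiusE (A : 'M[quat R]_2) q p : A 1 1 != 0 -> A 0 1 = - (A 1 1 * p) ->
  qabs p < 1 -> qabs q < 1 -> exists2 S, S = 1 + q * S * p &
  moebius A q = S * (A 1 1)^-1 * A 1 0 + q * S * (A 1 1)^-1 * A 0 0.
Proof.
move=> d0 cE p1 q1.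
have [S [cS SE]] := cvg_kernel q1 p1.
exists S => //.
rewrite /moebius /star coefs_lin (coefs_star_recip_lin d0 cE p1).
by rewrite (star_lin_coefs _ _ (cvg_kernel_mulr (d := (A 1 1)^-1) cS)) mulrA.
Qed.

End Kernel.

(** * Zeros of the Moebius transformations *)

Section Sp11Algebra.
Context {R : realType}.
Implicit Types (A B : 'M[quat R]_2) (a b c d p q u w : quat R).

Lemma matrix2P (T : Type) (A B : 'M[T]_2) :
  A 0 0 = B 0 0 -> A 0 1 = B 0 1 -> A 1 0 = B 1 0 -> A 1 1 = B 1 1 -> A = B.
Proof.
move=> h00 h01 h10 h11; apply/matrixP => i j.
case: i => -[|[|//]] hi; case: j => -[|[|//]] hj;
  [move: h00|move: h01|move: h10|move: h11];
  by congr (A _ _ = B _ _); apply/val_inj.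
Qed.

(** The columns of A are orthogonal for I_{1,1}, with squares 1 and -1. *)
Lemma Sp11E A : Sp11 R A <->
  [/\ qsqn (A 0 0) = 1 + qsqn (A 1 0), qsqn (A 1 1) = 1 + qsqn (A 0 1) &
      qconj (A 0 0) * A 0 1 = qconj (A 1 0) * A 1 1].
Proof.
have E i j : (adjoint A *m I11 R *m A) i j =
    qconj (A 0 i) * A 0 j - qconj (A 1 i) * A 1 j.
  rewrite !mxE !big_ord_recl big_ord0 addr0 !mxE !big_ord_recl !big_ord0 !addr0.
  rewrite !mxE /= mulr0n mulr1n mulr1 !mulr0 addr0 add0r mulrN1 mulNr.
  by rewrite (_ : lift ord0 ord0 = 1) //; exact/val_inj.
have R1 (x y : R) : x *: (1 : quat R) - y *: (1 : quat R) = 1 <-> x = 1 + y.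
  split=> [|->]; last by rewrite -scalerBl addrK scale1r.
  by move=> /(congr1 (@qr R)); rewrite !quatE !mulr1 => <-; rewrite subrK.
split.
  move=> SA; have H i j := congr1 (fun M : 'M[quat R]_2 => M i j) SA; split.
  - by have := H 0 0; rewrite E !mxE /= !qconj_mul => /R1.
  - have := H 1 1; rewrite E !mxE /= !qconj_mul => /(congr1 (@GRing.opp _)).
    by rewrite opprB opprK => /R1.
  - by have := H 0 1; rewrite E !mxE /= mulr0n => /eqP; rewrite subr_eq0 => /eqP.
move=> [h0 h1 h2]; apply: matrix2P; rewrite E !mxE /= ?mulr1n ?mulr0n.
- by rewrite !qconj_mul; apply/R1.
- by rewrite h2 subrr.
- have /(congr1 (@qconj R)) := h2; rewrite !qconjM !qconjK => ->.
  by rewrite subrr.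
- by apply: (can_inj opprK); rewrite opprB opprK !qconj_mul; apply/R1.
Qed.

Definition mkmx2 a c b d : 'M[quat R]_2 :=
  \matrix_(i, j) (if i == 0 then if j == 0 then a else c
                  else if j == 0 then b else d).

Lemma mkmx2E a c b d : (mkmx2 a c b d 0 0 = a) * (mkmx2 a c b d 0 1 = c) *
  (mkmx2 a c b d 1 0 = b) * (mkmx2 a c b d 1 1 = d).
Proof. by rewrite !mxE. Qed.

(** This is I_{1,1} A^* I_{1,1}, which is a left inverse of A by definition of
    Sp(1,1); that it is also a right inverse, hence in Sp(1,1), has to be
    proved as the coefficients do not commute. *)
Definition Sp11_inv A := mkmx2 (qconj (A 0 0)) (- qconj (A 1 0))
  (- qconj (A 0 1)) (qconj (A 1 1)).

Lemma Sp11_qsqn A : Sp11 R A ->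
  qsqn (A 0 0) = qsqn (A 1 1) /\ qsqn (A 1 0) = qsqn (A 0 1).
Proof.
move=> /Sp11E[h0 h1 /(congr1 (@qsqn R))]; rewrite !qsqnM !qsqn_conj h0 h1.
by move=> E; split; lra.
Qed.

Lemma Sp11_neq0 A : Sp11 R A -> A 0 0 != 0 /\ A 1 1 != 0.
Proof.
move=> /Sp11E[h0 h1 _].
have := qsqn_ge0 (A 1 0); have := qsqn_ge0 (A 0 1) => g0 g1.
by rewrite -!qsqn_eq0; split; rewrite gt_eqF// ?h0 ?h1; lra.
Qed.

(** The rows of A are orthogonal too: multiply the relation between its
    columns by a on the left and by conj d on the right, and use |a| = |d|. *)
Lemma Sp11_mul_conj A : Sp11 R A ->
  A 0 0 * qconj (A 1 0) = A 0 1 * qconj (A 1 1).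
Proof.
move=> SA; have [ad _] := Sp11_qsqn SA; have [_ d0] := Sp11_neq0 SA.
have /Sp11E[_ _ h] := SA.
have E : qsqn (A 1 1) *: (A 0 0 * qconj (A 1 0)) =
         qsqn (A 1 1) *: (A 0 1 * qconj (A 1 1)).
  rewrite -{2}ad [RHS]qscaleAl -(mul1r (A 0 1)) [X in _ = X * _]qscaleAl.
  rewrite -qmul_conj -!mulrA [X in _ = _ * X]mulrA h -!mulrA qmul_conj.
  by rewrite -!qscaleAr mulr1.
have dn0 : qsqn (A 1 1) != 0 by rewrite qsqn_eq0.
by rewrite -[LHS](scalerK dn0) E scalerK.
Qed.

Lemma mulmx_Sp11_inv A : Sp11 R A -> A *m Sp11_inv A = 1%:M.
Proof.
move=> SA; have [ad bc] := Sp11_qsqn SA; have h := Sp11_mul_conj SA.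
have /Sp11E[h0 h1 _] := SA.
have h' : A 1 0 * qconj (A 0 0) = A 1 1 * qconj (A 0 1).
  by have /(congr1 (@qconj R)) := h; rewrite !qconjM !qconjK.
have E i j : (A *m Sp11_inv A) i j =
    A i 0 * Sp11_inv A 0 j + A i 1 * Sp11_inv A 1 j.
  rewrite [LHS]mxE !big_ord_recl big_ord0 addr0.
  by rewrite (_ : lift ord0 ord0 = 1) //; exact/val_inj.
apply: matrix2P; rewrite E !mkmx2E ?mulrN [RHS]mxE /= ?mulr1n ?mulr0n.
- by rewrite !qmul_conj -scalerBl h0 bc addrK scale1r.
- by rewrite h addrC subrr.
- by rewrite h' subrr.
- by rewrite !qmul_conj addrC -scalerBl h1 bc addrK scale1r.
Qed.

Lemma Sp11_inv_Sp11 A : Sp11 R A -> Sp11 R (Sp11_inv A).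
Proof.
move=> SA; have [ad bc] := Sp11_qsqn SA; have h := Sp11_mul_conj SA.
have /Sp11E[h0 h1 _] := SA.
apply/Sp11E; rewrite !mkmx2E !qsqnN !qsqn_conj !qconjN !qconjK !mulNr !mulrN.
by rewrite -bc -h h0 h1 bc.
Qed.

(** The difference D of two solutions satisfies |D| = |q| |D| |p|. *)
Lemma kernel_unique q p (S T : quat R) : qabs q < 1 -> qabs p < 1 ->
  S = 1 + q * S * p -> T = 1 + q * T * p -> S = T.
Proof.
rewrite !qabs_lt1 => q1 p1 SE TE; apply/eqP; rewrite -subr_eq0 -qsqn_eq0.
have E : S - T = q * (S - T) * p.
  by rewrite {1}SE {1}TE opprD addrACA subrr add0r mulrBr mulrBl.
have := qsqn_ge0 (S - T); have := congr1 (@qsqn R) E; rewrite !qsqnM.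
set s := qsqn (S - T) => sE s0.
have := mulr_ilt1 (qsqn_ge0 q) (qsqn_ge0 p) q1 p1 => qp1.
by apply/eqP; nra.
Qed.

Definition moebius_root A : quat R := - qconj ((A 1 1)^-1 * A 0 1).

Lemma moebius_root_lt1 A : Sp11 R A -> qabs (moebius_root A) < 1.
Proof.
move=> SA; have [_ d0] := Sp11_neq0 SA; have /Sp11E[_ h1 _] := SA.
have := qsqn_ge0 (A 0 1) => c0.
rewrite qabs_lt1 qsqnN qsqn_conj qsqnM qsqnV mulrC ltr_pdivrMr; last first.
  by rewrite h1; lra.
by rewrite mul1r h1; lra.
Qed.

(** The orthogonality of the columns of A amounts to d^-1 b = - w d^-1 a,
    where w is the root; the factor d^-1 a then comes out of [moebiusE]. *)
Lemma moebius_factor A q : Sp11 R A -> qabs q < 1 ->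
  exists2 S, S = 1 + q * S * qconj (moebius_root A) &
  moebius A q = (q * S - S * moebius_root A) * ((A 1 1)^-1 * A 0 0).
Proof.
move=> SA q1; have [_ d0] := Sp11_neq0 SA; have /Sp11E[_ _ h] := SA.
have pE : qconj (moebius_root A) = - ((A 1 1)^-1 * A 0 1).
  by rewrite /moebius_root qconjN qconjK.
have cE : A 0 1 = - (A 1 1 * qconj (moebius_root A)).
  by rewrite pE mulrN opprK mulVKr.
have p1 : qabs (qconj (moebius_root A)) < 1.
  by rewrite qabs_conj; exact: moebius_root_lt1.
have [S SE ->] := moebiusE d0 cE p1 q1; exists S => //.
have bE : moebius_root A * ((A 1 1)^-1 * A 0 0) = - ((A 1 1)^-1 * A 1 0).
  have h' : qconj (A 0 1) * A 0 0 = qconj (A 1 1) * A 1 0.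
    by have /(congr1 (@qconj R)) := h; rewrite !qconjM !qconjK.
  rewrite /moebius_root qconjM mulNr; congr (- _).
  rewrite -mulrA [X in _ * X]mulrA qconj_mul -qscaleAl mul1r -qscaleAr h'.
  by rewrite qsqnV qscaleAl.
rewrite mulrBl -[X in _ - X]mulrA bE mulrN opprK addrC.
by rewrite !mulrA.
Qed.

(** If q S = S w, then S = 1 + S w (conj w) = 1 + |w|^2 S, so that S is real,
    hence central, and q = w. At q = w the kernel is 1 / (1 - |w|^2). *)
Lemma moebius_eq0 A q : Sp11 R A -> qabs q < 1 ->
  moebius A q = 0 <-> q = moebius_root A.
Proof.
move=> SA q1; have [S SE ->] := moebius_factor SA q1.
have [a0 d0] := Sp11_neq0 SA; have w1 := moebius_root_lt1 SA.
set w := moebius_root A in SE w1 *.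
have v1 : 1 - qsqn w != 0.
  by move: w1; rewrite qabs_lt1 => w1; rewrite subr_eq0 eq_sym lt_eqF.
split=> [E|qw].
  have qS : q * S = S * w.
    apply/eqP; rewrite -subr_eq0 -qsqn_eq0; apply/eqP.
    have /(congr1 (@qsqn R)) := E; rewrite !qsqnM qsqn0 => /eqP.
    rewrite !mulf_eq0 qsqnV invr_eq0 !qsqn_eq0 (negPf a0) (negPf d0) !orbF.
    by move=> /eqP ->; rewrite qsqn0.
  have S1 : S = (1 - qsqn w)^-1 *: (1 : quat R).
    have : (1 - qsqn w) *: S = 1.
      rewrite scalerBl scale1r {1}SE qS -mulrA qmul_conj -qscaleAr mulr1.
      by rewrite addrK.
    by move=> <-; rewrite scalerK.
  move: qS; rewrite S1 -qscaleAr -qscaleAl mulr1 mul1r.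
  by move/(can_inj (scalerK (invr_neq0 v1))).
suff S1 : S = (1 - qsqn w)^-1 *: (1 : quat R).
  by rewrite S1 qw -qscaleAr -qscaleAl mulr1 mul1r subrr mul0r.
apply: (kernel_unique q1 _ SE); first by rewrite qabs_conj.
rewrite qw -qscaleAr mulr1 -qscaleAl qmul_conj scalerA.
rewrite -{2}(scale1r (1 : quat R)) -scalerDl; congr (_ *: _).
by field.
Qed.

(** The kernel depends only on q and the root, so the two transformations
    differ by their factors d^-1 a, which have modulus 1. *)
Lemma moebius_same_root A B : Sp11 R A -> Sp11 R B ->
  moebius_root A = moebius_root B ->
  exists2 u, Sp1 u & forall q, qabs q < 1 -> moebius B q = moebius A q * u.
Proof.
move=> SA SB wE.
have [[a0 d0] [a0' d0']] := (Sp11_neq0 SA, Sp11_neq0 SB).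
have hU (M : 'M[quat R]_2) : Sp11 R M -> qsqn ((M 1 1)^-1 * M 0 0) = 1.
  move=> SM; have [ad _] := Sp11_qsqn SM; have [_ d1] := Sp11_neq0 SM.
  by rewrite qsqnM qsqnV ad mulVf// qsqn_eq0.
have hn0 : (A 1 1)^-1 * A 0 0 != 0 by rewrite -qsqn_eq0 hU// oner_eq0.
exists (((A 1 1)^-1 * A 0 0)^-1 * ((B 1 1)^-1 * B 0 0)).
  by apply/qabs_eq1; rewrite qsqnM qsqnV !hU// invr1 mulr1.
move=> q q1; have [S SE ->] := moebius_factor SA q1.
have [T TE ->] := moebius_factor SB q1.
have w1 := moebius_root_lt1 SA.
rewrite -wE in TE *; have <- : S = T.
  by apply: kernel_unique SE TE => //; rewrite qabs_conj.
by rewrite -[RHS]mulrA mulVKr.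
Qed.

(** The unit diagonal matrices give the rotations R_u. *)
Lemma moebius_rotation u q : Sp1 u -> qabs q < 1 ->
  Sp11 R (mkmx2 u 0 0 1) /\ moebius (mkmx2 u 0 0 1) q = q * u.
Proof.
move=> /qabs_eq1 u1 q1.
have SA : Sp11 R (mkmx2 u 0 0 1).
  by apply/Sp11E; rewrite !mkmx2E u1 qsqn0 qsqn1 addr0 qconj0 mulr0 mul0r.
split => //; have [S SE ->] := moebius_factor SA q1.
move: SE; rewrite /moebius_root !mkmx2E mulr0 qconj0 oppr0 qconj0 !mulr0 addr0.
move=> ->.
by rewrite invr1 mul1r mulr1 subr0.
Qed.

End Sp11Algebra.

(** * Orbits as fibres of the inverse orbit map *)

Section Orbits.
Context {R : realType}.
Implicit Types F G : Moeb R.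

Lemma ball_lt1 (q : unit_ball R) : qabs (\val q) < 1.
Proof. exact: (set_mem (valP q)). Qed.

Lemma MoebP F : exists2 A, Sp11 R A &
  forall q, \val (\val F q) = moebius A (\val q).
Proof. exact: (set_mem (valP F)). Qed.

Lemma ball_mk (q : quat R) : qabs q < 1 -> exists b : unit_ball R, \val b = q.
Proof. by move=> q1; exists (exist _ q (mem_set q1)). Qed.

Lemma Moeb_eq0 F A : Sp11 R A ->
  (forall q, \val (\val F q) = moebius A (\val q)) ->
  forall q, \val F q = ball_origin R <-> \val q = moebius_root A.
Proof.
move=> SA FA q; rewrite -(moebius_eq0 SA (ball_lt1 q)) -FA.
by split=> [->//|F0]; exact: val_inj.
Qed.

Lemma inv_orbit0_root F A : Sp11 R A ->
  (forall q, \val (\val F q) = moebius A (\val q)) ->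
  \val (inv_orbit0 F) = moebius_root A.
Proof.
move=> SA FA; apply/(Moeb_eq0 SA FA).
rewrite /inv_orbit0 pinvK//; apply: mem_set.
have [b bE] := ball_mk (moebius_root_lt1 SA).
by exists b => //; apply/(Moeb_eq0 SA FA).
Qed.

(** The zero of F is unique, so the choice made by the partial inverse in
    [inv_orbit0] is the expected one. *)
Lemma inv_orbit0P F q : \val F q = ball_origin R <-> q = inv_orbit0 F.
Proof.
have [A SA FA] := MoebP F; rewrite (Moeb_eq0 SA FA) -(inv_orbit0_root SA FA).
by split=> [/val_inj|->].
Qed.

Lemma Moeb_rotation (u : quat R) : Sp1 u ->
  exists2 F0 : Moeb R, Moeb0 F0 & forall q, \val (\val F0 q) = \val q * u.
Proof.
move=> u1.
have B1 (q : unit_ball R) : qabs (\val q * u) < 1.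
  by rewrite qabsM (_ : qabs u = 1)// mulr1 ball_lt1.
pose f (q : unit_ball R) : unit_ball R := exist _ (\val q * u) (mem_set (B1 q)).
have Mf : Moeb R f.
  exists (mkmx2 u 0 0 1).
    by have [] := moebius_rotation u1 (ball_lt1 (ball_origin R)).
  by move=> q; have [_ ->] := moebius_rotation u1 (ball_lt1 q).
exists (exist _ f (mem_set Mf)) => //.
by apply: val_inj; rewrite /= mul0r.
Qed.

(** The orbits are the fibres of F |-> F^-1(0). Elements of M(B)_0 fix 0, so
    zeros are constant on orbits; conversely two transformations with the
    same zero differ by a rotation, which belongs to M(B)_0. *)
Lemma Moeb_orbitE F : Moeb_orbit F = [set G | inv_orbit0 G = inv_orbit0 F].
Proof.
apply/seteqP; split=> G /=.
  move=> [F0 F00 GE]; apply/esym/inv_orbit0P; rewrite GE /=.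
  by have /inv_orbit0P -> := erefl (inv_orbit0 F).
move=> GF; have [A SA FA] := MoebP F; have [B SB GB] := MoebP G.
have [u u1 uE] : exists2 u, Sp1 u & forall q : quat R, qabs q < 1 ->
    moebius B q = moebius A q * u.
  apply: (moebius_same_root SA SB).
  by rewrite -(inv_orbit0_root SA FA) -(inv_orbit0_root SB GB) GF.
have [F0 F00 F0E] := Moeb_rotation u1.
exists F0 => //; apply/funext => q; apply: val_inj.
by rewrite /= F0E FA GB uE// ball_lt1.
Qed.

Lemma Moeb_proj_eq F G :
  Moeb_proj F = Moeb_proj G <-> inv_orbit0 F = inv_orbit0 G.
Proof.
split=> [/(congr1 val) /= E|E]; last by apply: val_inj; rewrite /= !Moeb_orbitE E.
have : Moeb_orbit F F by rewrite Moeb_orbitE.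
by rewrite E Moeb_orbitE.
Qed.

Lemma image_proj_surj (T U : Type) (f : T -> U) (y : range f) :
  exists x, image_proj f x = y.
Proof. by have [x _ xy] := set_mem (valP y); exists x; apply: val_inj. Qed.

End Orbits.

(** * Smoothness, and the diffeomorphism with the ball *)

Section SmoothQuat.
Context {R : realType} {V : normedModType R} (k : nat) (U : set V).
Hypothesis oU : open U.

Lemma CkN_qmul (f g : V -> quat R) :
  CkN k U f -> CkN k U g -> CkN k U (fun x => f x * g x).
Proof.
move=> cf cg.
apply: (CkN_ext oU (f := fun x =>
  \sum_i (f x) 0 i *: ((delta_mx 0 i : quat R) * g x))).
  move=> x _; rewrite [in RHS](row_sum_delta (f x)) mulr_suml.
  by apply: eq_bigr => i _; rewrite qscaleAl.
apply: (CkN_sum oU) => i _; apply: (CkN_scale oU); first exact: CkN_coord.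
pose lM := GRing.isLinear.Build _ _ _ _ _ (@qmull_linear R (delta_mx 0 i)).
pose L : {linear 'rV[R]_4 -> 'rV[R]_4} :=
  HB.pack (fun q : quat R => (delta_mx 0 i : quat R) * q) lM.
by apply: (@CkN_complin _ _ _ _ k U L g oU) => //; exact: rV_linear_continuous.
Qed.

Lemma CkN_qconj (f : V -> quat R) : CkN k U f -> CkN k U (fun x => qconj (f x)).
Proof.
have lc : linear (@qconj R) by move=> x u v; rewrite qconjD qconjZ.
pose lM := GRing.isLinear.Build _ _ _ _ _ lc.
pose L : {linear 'rV[R]_4 -> 'rV[R]_4} := HB.pack (@qconj R) lM.
by apply: (@CkN_complin _ _ _ _ k U L f oU); exact: rV_linear_continuous.
Qed.

Lemma CkN_qsqn (f : V -> quat R) : CkN k U f -> CkN k U (fun x => qsqn (f x)).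
Proof.
move=> cf.
apply: (CkN_ext oU (f := fun x => (f x * qconj (f x)) 0 0 : R)).
  by move=> x _; rewrite qmul_conj mxE -[X in _ * X]/(qr 1) quat1E mulr1.
by apply: (CkN_coord _ _ oU); apply: CkN_qmul => //; exact: CkN_qconj.
Qed.

Lemma CkN_row_mx m n1 n2 (f : V -> 'M[R]_(m, n1)) (g : V -> 'M[R]_(m, n2)) :
  CkN k U f -> CkN k U g -> CkN k U (fun x => row_mx (f x) (g x)).
Proof.
move=> cf cg; apply: (CkN_mx oU) => i j.
case: (split_ordP j) => l ->.
  apply: (CkN_ext oU (f := fun x => f x i l)) => [x _|].
    by rewrite row_mxEl.
  exact: CkN_coord.
apply: (CkN_ext oU (f := fun x => g x i l)) => [x _|].
  by rewrite row_mxEr.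
exact: CkN_coord.
Qed.

Lemma CkN_lsubmx n1 n2 (f : V -> 'rV[R]_(n1 + n2)) :
  CkN k U f -> CkN k U (fun x => lsubmx (f x)).
Proof.
move=> cf; apply: (CkN_mx oU) => i j.
apply: (CkN_ext oU (f := fun x => f x i (lshift n2 j))) => [x _|].
  by rewrite mxE.
exact: CkN_coord.
Qed.

Lemma CkN_rsubmx n1 n2 (f : V -> 'rV[R]_(n1 + n2)) :
  CkN k U f -> CkN k U (fun x => rsubmx (f x)).
Proof.
move=> cf; apply: (CkN_mx oU) => i j.
apply: (CkN_ext oU (f := fun x => f x i (rshift n1 j))) => [x _|].
  by rewrite mxE.
exact: CkN_coord.
Qed.

End SmoothQuat.

(** Induction on k, as d(sqrt f) = df / (2 sqrt f) only involves sqrt f. *)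
Lemma CkN_sqrt (R : realType) (V : normedModType R) k (U : set V) (f : V -> R) :
  open U -> (forall x, U x -> 0 < f x) -> CkN k U f ->
  CkN k U (fun x => Num.sqrt (f x)).
Proof.
move=> oU f0; elim: k => [|k IH].
  move=> cf x Ux; apply: (@cvg_comp _ _ _ f (@Num.sqrt R)); first exact: cf.
  exact: sqrt_continuous.
move=> Cf; have [df cf] := Cf.
have D x (Ux : U x) : is_diff x (fun y => Num.sqrt (f y))
    (fun v => 'd f x v * (2 * Num.sqrt (f x))^-1).
  have d1 := is_derive1_sqrt (f0 x Ux).
  have d2 : differentiable (@Num.sqrt R) (f x).
    by apply/derivable1_diffP; exact: (@ex_derive _ _ _ _ _ _ _ d1).
  have d3 : is_diff (f x) (@Num.sqrt R) (fun h => h * (2 * Num.sqrt (f x))^-1).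
    apply: DiffDef => //.
    rewrite deriv1E; last by apply/derivable1_diffP.
    apply/funext => h; rewrite derive1E.
    by rewrite (@derive_val _ _ _ _ _ _ _ d1).
  exact: (is_diff_comp (differentiableP (df x Ux)) d3).
split=> [x Ux|v]; first exact: (is_diff_differentiable (D x Ux)).
apply: (CkN_ext oU (f := fun x => 'd f x v * (2 * Num.sqrt (f x))^-1)).
  by move=> x Ux; exact: (esym (is_diffE v (D x Ux))).
apply: (CkN_mul oU); [exact: cf|apply: (CkN_inv oU) => [x Ux|]].
  by rewrite mulf_neq0// gt_eqF// sqrtr_gt0 f0.
by apply: CkN_mul => //; [exact: CkN_cst|apply: IH; exact: CkNS].
Qed.

Section BallAtlas.
Context {R : realType}.

Lemma open_unit_ball : open (unit_ball R).
Proof.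
have -> : unit_ball R = @qsqn R @^-1` [set x | x < 1].
  by apply/seteqP; split=> q /=; rewrite /unit_ball/= qabs_lt1.
apply: open_comp; last exact: open_lt.
move=> q _; have : CkN 0 [set: quat R] (@qsqn R).
  apply: (@CkN_qsqn _ _ _ _ _ id); first exact: openT.
  by move=> x _; exact: cvg_id.
by apply.
Qed.

Lemma overlap_ball (M : Type) m (f : M -> unit_ball R) (c : chart R M m) :
  overlap f c (Chart setT (fun q : unit_ball R => \val q : 'rV[R]_4)) =
  cmap c @` cdom c.
Proof. by rewrite /overlap preimage_setT setIT. Qed.

Lemma overlap_euclidean (M : Type) m n (f : M -> 'rV[R]_n) (c : chart R M m) :
  overlap f c (Chart setT id) = cmap c @` cdom c.
Proof. by rewrite /overlap preimage_setT setIT. Qed.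

Lemma image_val_ball :
  (fun q : unit_ball R => \val q : 'rV[R]_4) @` setT = unit_ball R.
Proof.
apply/seteqP; split=> [_ [q _ <-]|q q1]; first exact: (set_mem (valP q)).
by have [b bE] := ball_mk q1; exists b.
Qed.

Lemma ball_smooth_atlas : smooth_atlas (@ball_atlas R).
Proof.
split=> [c ->|x|c d -> ->] /=.
- by split=> [x y _ _ /val_inj//|]; rewrite image_val_ball; exact: open_unit_ball.
- by exists (Chart setT (fun q : unit_ball R => \val q : 'rV[R]_4)).
- rewrite overlap_ball /= image_val_ball; split; first exact: open_unit_ball.
  by exists id => //; exact: smooth_on_id.
Qed.

Lemma smooth_map_ball (M : Type) m (A : set (chart R M m))
    (f : M -> unit_ball R) :
  smooth_map A (@euclidean_atlas R 4) (fun x => \val (f x)) ->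
  smooth_map A (@ball_atlas R) f.
Proof.
move=> sf c d Ac ->; have := sf c _ Ac erefl.
by rewrite overlap_ball overlap_euclidean.
Qed.

Lemma smooth_map_ball_dom n (f : unit_ball R -> 'rV[R]_n)
    (g : 'rV[R]_4 -> 'rV[R]_n) :
  (forall q, f q = g (\val q)) -> smooth_on (unit_ball R) g ->
  smooth_map (@ball_atlas R) (@euclidean_atlas R n) f.
Proof.
move=> fg sg c d -> ->; rewrite overlap_euclidean /= image_val_ball.
split; first exact: open_unit_ball.
by exists g => // q _ _; rewrite /= fg.
Qed.

Lemma smooth_map_postcomp (M : Type) m n p (A : set (chart R M m))
    (f : M -> 'rV[R]_n) (W : set 'rV[R]_n) (g : 'rV[R]_n -> 'rV[R]_p) :
  open W -> (forall x, W (f x)) -> smooth_on W g ->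
  smooth_map A (@euclidean_atlas R n) f ->
  smooth_map A (@euclidean_atlas R p) (fun x => g (f x)).
Proof.
move=> oW fW sg sf c d Ac ->; have := sf c _ Ac erefl.
rewrite !overlap_euclidean => -[oO [F FE sF]]; split => //.
exists (g \o F); first by move=> x cx _; rewrite /= (FE _ cx).
apply: smooth_on_comp sF sg => // _ [x cx <-].
by rewrite (FE _ cx I); exact: fW.
Qed.

End BallAtlas.

Section SmoothSections.
Context {R : realType}.

Lemma qconjV (q : quat R) : qconj q^-1 = (qconj q)^-1.
Proof.
by rewrite -[q^-1]/(qinv q) -[(qconj q)^-1]/(qinv _) /qinv qconjZ qsqn_conj.
Qed.

Lemma qscale1V (t : R) : t != 0 ->
  (t *: (1 : quat R))^-1 = t^-1 *: (1 : quat R).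
Proof.
move=> t0.
rewrite -[LHS]/(qinv _) /qinv qsqnZ qsqn1 mulr1 qconjZ qconj1 scalerA.
by congr (_ *: _); field.
Qed.

(** For A^-1 the zero is b d^-1, which is visibly unchanged when A is
    multiplied on the right by a unit quaternion. *)
Lemma moebius_root_inv (A : 'M[quat R]_2) :
  moebius_root (Sp11_inv A) = A 1 0 * (A 1 1)^-1.
Proof.
by rewrite /moebius_root !mkmx2E mulrN qconjN opprK qconjM qconjV !qconjK.
Qed.

Lemma Sp11P (A : Sp11 R) : Sp11 R (\val A).
Proof. exact: (set_mem (valP A)). Qed.

Definition Sp11_root (A : Sp11 R) : unit_ball R :=
  exist _ (moebius_root (Sp11_inv (\val A)))
    (mem_set (moebius_root_lt1 (Sp11_inv_Sp11 (Sp11P A)))).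

Lemma Sp11_root_smooth nG (AG : set (chart R (Sp11 R) nG)) :
  smooth_map AG (@euclidean_atlas R 16) (@Sp11_coords R) ->
  smooth_map AG (@ball_atlas R) Sp11_root.
Proof.
move=> sc; apply: smooth_map_ball.
pose b (x : 'rV[R]_16) : quat R :=
  lsubmx (rsubmx (x : 'rV[R]_((4 + 4) + (4 + 4)))).
pose d (x : 'rV[R]_16) : quat R :=
  rsubmx (rsubmx (x : 'rV[R]_((4 + 4) + (4 + 4)))).
have cid k U : CkN k U (fun x : 'rV[R]_((4 + 4) + (4 + 4)) => x).
  by have /smooth_onE/(_ k) := smooth_on_id U.
have cb k U : open U -> CkN k U b.
  by move=> oU; apply: CkN_lsubmx => //; apply: CkN_rsubmx.
have cd k U : open U -> CkN k U d.
  by move=> oU; apply: CkN_rsubmx => //; apply: CkN_rsubmx.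
pose W := [set x | qsqn (d x) != 0].
have oW : open W.
  have -> : W = (@qsqn R \o d) @^-1` [set x | x != 0] by [].
  apply: open_comp; last exact: open_neq.
  move=> x _; have : CkN 0 [set: 'rV[R]_16] (@qsqn R \o d).
    by apply: CkN_qsqn; [exact: openT|exact/cd/openT].
  by apply.
pose g x := (qsqn (d x))^-1 *: (b x * qconj (d x)).
have -> : (fun A => \val (Sp11_root A)) = (fun A => g (Sp11_coords A)).
  apply/funext => A; rewrite /= moebius_root_inv.
  rewrite /g /b /d /Sp11_coords !row_mxKr !row_mxKl.
  by rewrite -[(\val A 1 1)^-1]/(qinv _) /qinv qscaleAr.
apply: (smooth_map_postcomp oW _ _ sc) => [A|].
  rewrite /W /= /d /Sp11_coords !row_mxKr qsqn_eq0.
  by have [] := Sp11_neq0 (Sp11P A).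
apply/smooth_onE => k; apply: (CkN_scale oW).
  by apply: (CkN_inv oW) => //; apply: (CkN_qsqn oW); exact: cd.
by apply: (CkN_qmul oW); [exact: cb|apply: (CkN_qconj oW); exact: cd].
Qed.

Definition section_scale (w : quat R) : R := (Num.sqrt (1 - qsqn w))^-1.

(** The positive hermitian element (1 - |w|^2)^(-1/2) [[1, conj w], [w, 1]] of
    Sp(1,1), for which b d^-1 = w. *)
Definition section_mx (w : quat R) : 'M[quat R]_2 :=
  let t := section_scale w in
  mkmx2 (t *: (1 : quat R)) (t *: qconj w) (t *: w) (t *: (1 : quat R)).

Lemma section_scale_sqr w : qsqn w < 1 ->
  section_scale w ^+ 2 = 1 + section_scale w ^+ 2 * qsqn w.
Proof.
move=> w1; have v0 : 0 < 1 - qsqn w by rewrite subr_gt0.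
by rewrite /section_scale exprVn sqr_sqrtr ?ltW//; field; rewrite gt_eqF.
Qed.

Lemma section_Sp11 w : qsqn w < 1 -> Sp11 R (section_mx w).
Proof.
move=> /section_scale_sqr t2; apply/Sp11E; rewrite /section_mx !mkmx2E.
rewrite !qsqnZ qsqn_conj qsqn1 mulr1 !qconjZ qconj1; split => //.
by rewrite -!qscaleAl -!qscaleAr mul1r mulr1.
Qed.

Definition ball_section (w : unit_ball R) : Sp11 R :=
  exist _ (section_mx (\val w))
    (mem_set (section_Sp11 ((unit_ballE _).1 (ball_lt1 w)))).

Lemma ball_sectionK w : Sp11_root (ball_section w) = w.
Proof.
apply: val_inj; rewrite /= moebius_root_inv !mkmx2E.
have w1 : qsqn (\val w) < 1 by exact: ((unit_ballE _).1 (ball_lt1 w)).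
have t0 : section_scale (\val w) != 0.
  by rewrite invr_eq0 gt_eqF// sqrtr_gt0 subr_gt0.
rewrite qscale1V// -qscaleAl -qscaleAr mulr1 scalerA -[RHS]scale1r; congr (_ *: _).
by rewrite mulfV.
Qed.

(** The matrix entries are smooth in w because 1 - |w|^2 is positive on the
    ball; smoothness into Sp(1,1) itself follows from [embedding_lift]. *)
Lemma ball_section_smooth nG (AG : set (chart R (Sp11 R) nG)) :
  smooth_atlas AG ->
  smooth_embedding AG (@euclidean_atlas R 16) (@Sp11_coords R) ->
  smooth_map (@ball_atlas R) AG ball_section.
Proof.
move=> hG emb; apply: (embedding_lift hG ball_smooth_atlas emb).
pose g (w : 'rV[R]_4) : 'rV[R]_16 :=
  row_mx (row_mx (section_mx w 0 0 : 'rV[R]_4) (section_mx w 0 1 : 'rV[R]_4))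
         (row_mx (section_mx w 1 0 : 'rV[R]_4) (section_mx w 1 1 : 'rV[R]_4)).
apply: (@smooth_map_ball_dom _ _ _ g) => //.
have oB := @open_unit_ball R.
have cid k U : CkN k U (id : quat R -> quat R).
  by have /smooth_onE/(_ k) := smooth_on_id U.
apply/smooth_onE => k.
have ct : CkN k (unit_ball R) (@section_scale).
  have B0 x : unit_ball R x -> 0 < 1 - qsqn x.
    by move/unit_ballE; rewrite subr_gt0.
  apply: (CkN_inv oB) => [x /B0 h|]; first by rewrite gt_eqF// sqrtr_gt0.
  apply: (CkN_sqrt oB) => //; apply: (CkN_add oB); first exact: CkN_cst.
  apply: (CkN_ext oB (f := fun x => -1 * qsqn x)) => [x _|].
    by rewrite mulN1r.
  by apply: (CkN_mul oB); [exact: CkN_cst|apply: (CkN_qsqn oB); exact: cid].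
have E w : g w = row_mx
    (row_mx (section_scale w *: (1 : quat R) : 'rV[R]_4)
            (section_scale w *: qconj w : 'rV[R]_4))
    (row_mx (section_scale w *: w : 'rV[R]_4)
            (section_scale w *: (1 : quat R) : 'rV[R]_4)).
  by rewrite /g !mkmx2E.
apply: (CkN_ext oB (fun x _ => esym (E x))).
apply: (CkN_row_mx oB); apply: (CkN_row_mx oB); apply: (CkN_scale oB) => //.
- exact: CkN_cst.
- by apply: (CkN_qconj oB); exact: cid.
- exact: CkN_cst.
Qed.

End SmoothSections.

Theorem theorem4p3p2 (R : realType) (nG nQ nM nO : nat)
    (* Sp(1,1), a submanifold of M_2(H) *)
    (AG : set (chart R (Sp11 R) nG))
    (hG : smooth_manifold AG)
    (hGemb : smooth_embedding AG (@euclidean_atlas R 16) (@Sp11_coords R))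
    (* Sp(1,1) / Sp(1)I_2 *)
    (AQ : set (chart R (Sp11_quo R) nQ))
    (hQ : smooth_manifold AQ)
    (hQsub : submersion AG AQ (@Sp11_proj R))
    (* M(B), diffeomorphic to the former by A Sp(1)I_2 |-> F_{A^-1};
       below, A' is the inverse of A *)
    (AM : set (chart R (Moeb R) nM))
    (hM : smooth_manifold AM)
    (hMdiff : exists2 phi : Sp11_quo R -> Moeb R,
       (forall A A' : Sp11 R, \val A *m \val A' = 1%:M ->
          forall q : unit_ball R,
            \val (\val (phi (Sp11_proj A)) q) = moebius (\val A') (\val q)) &
       diffeomorphism AQ AM phi)
    (* M(B)_0 \ M(B) *)
    (AO : set (chart R (Moeb_orbits R) nO))
    (hO : smooth_manifold AO)
    (hOsub : submersion AM AO (@Moeb_proj R)) :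
  smooth_map AM (@ball_atlas R) (@inv_orbit0 R) /\
  exists2 psi : Moeb_orbits R -> unit_ball R,
    (forall F : Moeb R, psi (Moeb_proj F) = inv_orbit0 F) &
    diffeomorphism AO (@ball_atlas R) psi.
Proof.
move: hG hQ hM hO => /smooth_manifold_atlas aG /smooth_manifold_atlas aQ
  /smooth_manifold_atlas aM /smooth_manifold_atlas aO.
have aB := @ball_smooth_atlas R.
have [phi phiE [phi' [phiK phiK' s_phi s_phi']]] := hMdiff.
have rootE A : inv_orbit0 (phi (Sp11_proj A)) = Sp11_root A.
  apply: val_inj; apply: (inv_orbit0_root (Sp11_inv_Sp11 (Sp11P A))) => q.
  pose A' : Sp11 R :=
    exist _ (Sp11_inv (\val A)) (mem_set (Sp11_inv_Sp11 (Sp11P A))).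
  by apply: (phiE A A'); exact: mulmx_Sp11_inv (Sp11P A).
(* pulled back to Sp(1,1), the map is A |-> b d^-1 *)
have s_quo : smooth_map AQ (@ball_atlas R) (@inv_orbit0 R \o phi).
  apply: (submersion_descent aG aQ aB hQsub (@image_proj_surj _ _ _)).
  have -> : (@inv_orbit0 R \o phi) \o @Sp11_proj R = @Sp11_root R.
    by apply/funext => A; exact: rootE.
  by have [[sG _] _ _] := hGemb; exact: Sp11_root_smooth.
have s_inv : smooth_map AM (@ball_atlas R) (@inv_orbit0 R).
  have -> : @inv_orbit0 R = (@inv_orbit0 R \o phi) \o phi'.
    by apply/funext => F; rewrite /= phiK'.
  exact: (smooth_map_comp aM aQ aB).
split; first exact: s_inv.
have /choice[rep repK] := @image_proj_surj _ _ (@Moeb_orbit R).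
pose psi o := inv_orbit0 (rep o).
have psiE F : psi (Moeb_proj F) = inv_orbit0 F.
  by apply/Moeb_proj_eq; exact: repK.
exists psi => //.
exists (fun w => Moeb_proj (phi (Sp11_proj (ball_section w)))); split.
- move=> o; rewrite -[RHS]repK; apply/Moeb_proj_eq.
  by rewrite rootE ball_sectionK.
- by move=> w; rewrite psiE rootE ball_sectionK.
- apply: (submersion_descent aM aO aB hOsub (@image_proj_surj _ _ _)).
  by have -> : psi \o @Moeb_proj R = @inv_orbit0 R by apply/funext.
- have s1 := ball_section_smooth aG hGemb.
  have s2 := smooth_map_comp aB aG aQ s1 hQsub.1.
  have s3 := smooth_map_comp aB aQ aM s2 s_phi.
  exact: (smooth_map_comp aB aM aO s3 hOsub.1).
Qed.
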